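(* For the quantum group $\mathfrak{D}$ at $\mathbb{S}_3$ attached to the 12-dimensional Fomin–Kirillov algebra, the nonzero proper $\mathfrak{D}$-submodules of the Verma module $\mathsf{M}(e,+)$ are $\mathsf{S}(e,+)\subset\mathsf{X}(e,+)$, where (i) $\mathsf{X}(e,+)=\bigoplus_{n<0}\mathsf{M}^n(e,+)$ is a highest-weight submodule of weight $(\sigma,-)$; (ii) $\mathsf{S}(e,+)=\mathsf{M}_{\mathsf{soc}}=\mathfrak{B}^4(V)\otimes M(e,+)$ is a highest-weight submodule of weight $(e,+)$. Therefore the composition factors of $\mathsf{M}(e,+)$, counted with multiplicity, are $\mathsf{L}(e,+),\mathsf{L}(\sigma,-),\mathsf{L}(e,+)$.
   Context: $\Bbbk$ is an algebraically closed field of characteristic zero, $\zeta\in\Bbbk$ a fixed primitive cube root of $1$; $\sigma=(12)$, $\tau=(123)$ in $\mathbb{S}_3$, permutations composed right to left, so $\sigma\tau=(23)$, $\sigma\tau^2=(13)$. $V=\Bbbk\{x_{(12)},x_{(23)},x_{(13)}\}$ is the Yetter–Drinfeld module over $\Bbbk\mathbb{S}_3$ with $g\cdot x_{(ij)}=\mathrm{sgn}(g)x_{g(ij)g^{-1}}$ and coaction $x_{(ij)}\mapsto(ij)\otimes x_{(ij)}$. Its Nichols algebra $\mathfrak{B}(V)=\bigoplus_{n=0}^4\mathfrak{B}^n(V)$ is the 12-dimensional Fomin–Kirillov algebra. $\mathfrak{D}$ is the Drinfeld double of the bosonization $\mathfrak{B}(V)\#\Bbbk\mathbb{S}_3$.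 Explicitly, $\mathfrak{D}$ is the algebra generated by $x_{(ij)}$, $y_{(ij)}$ (transpositions $(ij)$) and $g,\delta_g$ ($g\in\mathbb{S}_3$), where the $g$ multiply as in $\mathbb{S}_3$, the $\delta_g$ are orthogonal idempotents with sum $1$, and, for distinct $i,j,k$ and $g,h\in\mathbb{S}_3$: $x_{(ij)}^2=0$, $x_{(ij)}x_{(ik)}+x_{(jk)}x_{(ij)}+x_{(ik)}x_{(jk)}=0$; the same relations for the $y$'s; $\delta_hg=g\delta_{g^{-1}hg}$; $gx_{(ij)}=\mathrm{sgn}(g)x_{g(ij)g^{-1}}g$; $\delta_hx_{(ij)}=x_{(ij)}\delta_{(ij)h}$; $\delta_gy_{(ij)}=y_{(ij)}\delta_{(ij)g}$; $y_{(ij)}g=\mathrm{sgn}(g)\,g\,y_{g^{-1}(ij)g}$; $y_{(ij)}x_{(ij)}+x_{(ij)}y_{(ij)}=1+(ij)(\delta_{(ij)}-\delta_e)$; $y_{(ik)}x_{(ij)}+x_{(ij)}y_{(jk)}=(ij)(\delta_{(ik)}-\delta_{(ik)(ij)})$. The $g,\delta_g$ generate the Drinfeld double $\mathfrak{D}(\mathbb{S}_3)$ of $\Bbbk\mathbb{S}_3$; $\overline V=\Bbbk\{y_{(ij)}\}$ generates $\mathfrak{B}(\overline V)$; multiplication $\mathfrak{B}(V)\otimes\mathfrak{D}(\mathbb{S}_3)\otimes\mathfrak{B}(\overline V)\to\mathfrak{D}$ is a linear isomorphism. Simple $\mathfrak{D}(\mathbb{S}_3)$-modules relevant here (''degree $h$''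 means $\delta_h$ acts as identity and other $\delta$'s by $0$): $M(e,+)=\Bbbk|e\rangle$ in degree $e$ with $g$ acting by $1$; $M(\sigma,-)$ with basis $|12\rangle,|23\rangle,|13\rangle$, $|ij\rangle$ of degree $(ij)$, $g|ij\rangle=\mathrm{sgn}(g)|g(ij)g^{-1}\rangle$. A $\mathfrak{D}(\mathbb{S}_3)$-module is of weight $(g,\varrho)$ if it is isomorphic to $M(g,\varrho)$. Let $\mathfrak{D}^{\ge0}$ be the subalgebra generated by $\mathfrak{D}(\mathbb{S}_3)$ and $\overline V$; a simple $\mathfrak{D}(\mathbb{S}_3)$-module $M(g,\varrho)$ is a $\mathfrak{D}^{\ge0}$-module with $\overline V$ acting by $0$. The Verma module is $\mathsf{M}(g,\varrho)=\mathfrak{D}\otimes_{\mathfrak{D}^{\ge0}}M(g,\varrho)=\mathfrak{B}(V)\otimes M(g,\varrho)$, graded with $\mathsf{M}^n(g,\varrho)=\mathfrak{B}^{-n}(V)\otimes M(g,\varrho)$, $n\le0$. $\mathsf{X}(g,\varrho)$ is its unique maximal $\mathfrak{D}$-submodule, $\mathsf{L}(g,\varrho)$ its head and $\mathsf{S}(g,\varrho)$ its socle. A $\mathfrak{D}$-module is a highest-weight module of weight $(g,\varrho)$ if it is generated by a $\mathfrak{D}(\mathbb{S}_3)$-submodule $M$ of weight $(g,\varrho)$ with $\overline VM=0$. *)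

(* Defs.v *)
From HB Require Import structures.
From mathcomp Require Import all_fingroup all_boot all_algebra.
From mathcomp Require Import boolp.

Set Implicit Arguments.
Unset Strict Implicit.
Unset Printing Implicit Defensive.

Import GRing.Theory.
Local Open Scope ring_scope.
Local Open Scope quotient_scope.

(* Submodules of W are inhabitants of [submodClosed W], compared with [=i]. *)
Section Modules.
Variable R : pzRingType.
Implicit Types U V W : lmodType R.

Definition isomorphic U V : Prop := exists f : {linear U -> V}, bijective f.

Definition zero_submod W (N : submodClosed W) : Prop :=
  forall w, w \in N -> w = 0.

Definition full_submod W (N : submodClosed W) : Prop := forall w, w \in N.

Definition simple_module W : Prop :=
  (exists w : W, w != 0) /\
  forall N : submodClosed W, zero_submod N \/ full_submod N.

Definition maximal_submod W (N : submodClosed W) : Prop :=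
  ~ full_submod N /\
  forall N' : submodClosed W, {subset N <= N'} -> full_submod N' \/ N' =i N.

Definition unique_maximal_submod W (N : submodClosed W) : Prop :=
  maximal_submod N /\
  forall N' : submodClosed W, maximal_submod N' -> N' =i N.

Record submod W (N : submodClosed W) :=
  Submod { submod_val : W; submod_valP : submod_val \in N }.
Arguments submod_val {W N}.

HB.instance Definition _ W (N : submodClosed W) := [isSub for @submod_val W N].
HB.instance Definition _ W (N : submodClosed W) :=
  [Choice of submod N by <:].
HB.instance Definition _ W (N : submodClosed W) :=
  [SubChoice_isSubLmodule of submod N by <:].

Section Generated.
Variables (W : lmodType R) (A : W -> Prop).

Definition gen_pred : {pred W} := fun w =>
  `[< forall N : submodClosed W, (forall a, A a -> a \in N) -> w \in N >].

Lemma gen_pred_closed : GRing.subsemimod_closed gen_pred.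
Proof.
split; first split.
- by apply/asboolP => N _; exact: rpred0.
- move=> u v /asboolP hu /asboolP hv; apply/asboolP => N hN.
  by rewrite rpredD ?hu ?hv.
- move=> a v /asboolP hv; apply/asboolP => N hN.
  by rewrite rpredZ ?hv.
Qed.

HB.instance Definition _ := GRing.isSubmodClosed.Build R W gen_pred gen_pred_closed.

Definition submod_generated : submodClosed W := gen_pred.
End Generated.

Definition mod_socle W : submodClosed W :=
  submod_generated
    (fun w => exists2 N : submodClosed W, simple_module (submod N) & w \in N).

Section Radical.
Variable W : lmodType R.

Definition rad_pred : {pred W} := fun w =>
  `[< forall N : submodClosed W, maximal_submod N -> w \in N >].

Lemma rad_pred_closed : GRing.subsemimod_closed rad_pred.
Proof.
split; first split.
- by apply/asboolP => N _; exact: rpred0.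
- move=> u v /asboolP hu /asboolP hv; apply/asboolP => N hN.
  by rewrite rpredD ?hu ?hv.
- move=> a v /asboolP hv; apply/asboolP => N hN.
  by rewrite rpredZ ?hv.
Qed.

HB.instance Definition _ := GRing.isSubmodClosed.Build R W rad_pred rad_pred_closed.

(* The intersection of the maximal submodules; it is the unique maximal
   submodule as soon as there is exactly one. *)
Definition mod_radical : submodClosed W := rad_pred.
End Radical.

(* The quotient group is the library's; only the scaling is added. *)
Section QuotientModule.
Variables (W : lmodType R) (N : submodClosed W).

Definition zpred : {pred W} := fun w => w \in N.

Lemma zpred_closed : zmod_closed zpred.
Proof. exact: GRing.submod_closedB (GRing.submodClosedP N). Qed.

HB.instance Definition _ := GRing.isZmodClosed.Build W zpred zpred_closed.

Definition quomod := Quotient.quot zpred.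
HB.instance Definition _ := GRing.Zmodule.on quomod.

Definition quomod_pi (w : W) : quomod := \pi_(Quotient.quot zpred) w.

Lemma quomod_piP u v : quomod_pi u = quomod_pi v <-> u - v \in N.
Proof.
have -> : (u - v \in N) = (u - v \in zpred) by [].
by rewrite Quotient.idealrBE; split=> /eqP.
Qed.

Lemma quomod_piD u v : quomod_pi (u + v) = quomod_pi u + quomod_pi v.
Proof. exact: (Quotient.pi_add zpred). Qed.

Lemma quomod_reprK (x : quomod) : quomod_pi (repr x) = x.
Proof. exact: reprK. Qed.

Definition quomod_scale (a : R) (x : quomod) : quomod :=
  quomod_pi (a *: repr x).

Lemma quomod_scale_pi a w : quomod_scale a (quomod_pi w) = quomod_pi (a *: w).
Proof.
apply/quomod_piP; rewrite -scalerBr rpredZ //.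
by apply/quomod_piP; rewrite quomod_reprK.
Qed.

Lemma quomod_scalerA a b x :
  quomod_scale a (quomod_scale b x) = quomod_scale (a * b) x.
Proof. by rewrite -[x]quomod_reprK !quomod_scale_pi scalerA. Qed.

Lemma quomod_scale1r : left_id 1 quomod_scale.
Proof. by move=> x; rewrite -[x]quomod_reprK quomod_scale_pi scale1r. Qed.

Lemma quomod_scalerDr : right_distributive quomod_scale +%R.
Proof.
move=> a x y; rewrite -[x]quomod_reprK -[y]quomod_reprK.
by rewrite -quomod_piD !quomod_scale_pi scalerDr quomod_piD.
Qed.

Lemma quomod_scalerDl x : {morph quomod_scale^~ x : a b / a + b}.
Proof.
move=> a b; rewrite -[x]quomod_reprK.
by rewrite !quomod_scale_pi scalerDl quomod_piD.
Qed.

HB.instance Definition _ := GRing.Zmodule_isLmodule.Build R quomod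
  quomod_scalerA quomod_scale1r quomod_scalerDr quomod_scalerDl.
End QuotientModule.

Definition module_head W : lmodType R := quomod (mod_radical W).

Section SubQuotient.
Variables (W : lmodType R) (A B : submodClosed W).

Definition trace_pred : {pred submod A} := fun u => submod_val u \in B.

Lemma trace_pred_closed : GRing.subsemimod_closed trace_pred.
Proof.
split; first split.
- exact: rpred0.
- by move=> u v hu hv; rewrite unfold_in /trace_pred /= rpredD.
- by move=> a v hv; rewrite unfold_in /trace_pred /= rpredZ.
Qed.

HB.instance Definition _ :=
  GRing.isSubmodClosed.Build R (submod A) trace_pred trace_pred_closed.

(* A / B, for B contained in A *)
Definition subquo : lmodType R := quomod (trace_pred : submodClosed (submod A)).
End SubQuotient.

Definition composition_series W n (N : nat -> submodClosed W) : Prop :=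
  [/\ zero_submod (N 0%N), full_submod (N n) &
      forall i, (i < n)%N ->
        {subset N i <= N i.+1} /\ simple_module (subquo (N i.+1) (N i))].

(* The multiset of factors does not depend on the series (Jordan-Hoelder);
   they are listed up to the permutation s. *)
Definition composition_factors W n (L : 'I_n -> lmodType R) : Prop :=
  exists N : nat -> submodClosed W, composition_series n N /\
  exists s : 'S_n, forall i : 'I_n, isomorphic (subquo (N i.+1) (N i)) (L (s i)).

Definition internal_direct_sum W (I : finType) (P : I -> W -> Prop)
    (N : submodClosed W) : Prop :=
  (forall w, w \in N <->
     exists2 u : I -> W, forall i, P i (u i) & w = \sum_i u i) /\
  (forall u : I -> W, (forall i, P i (u i)) ->
     \sum_i u i = 0 -> forall i, u i = 0).

End Modules.

(* MathComp's product of permutations composes left to right: with products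
   read right to left, g h is (h * g)%g and g h g^-1 is (h ^ g)%g. *)
Notation "g ∘∘ h" := (mulg h%g g%g) (at level 40, left associativity).

Definition is_transp (s : 'S_3) : bool :=
  [exists i, exists j, (i != j) && (s == tperm i j)].

Definition transp := {s : 'S_3 | is_transp s}.

Lemma is_transp_tperm i j : i != j -> is_transp (tperm i j).
Proof.
by move=> h; apply/existsP; exists i; apply/existsP; exists j; rewrite h eqxx.
Qed.

Definition tp i j (h : i != j) : transp := exist _ (tperm i j) (is_transp_tperm h).

Lemma is_transpJ s (g : 'S_3) : is_transp s -> is_transp (s ^ g)%g.
Proof.
case/existsP=> i /existsP[j /andP[h /eqP->]].
by rewrite tpermJ is_transp_tperm // (inj_eq perm_inj).
Qed.

(* g t g^-1 *)
Definition transpJ (g : 'S_3) (t : transp) : transp :=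
  exist _ (val t ^ g)%g (is_transpJ g (valP t)).

Lemma transp_neq1 (t : transp) : (val t == 1)%g = false.
Proof.
case: t => s /=; case/existsP=> i /existsP[j /andP[h /eqP->]].
apply/negbTE/eqP => /(congr1 (fun p : 'S_3 => p i)).
by rewrite tpermL perm1 => /esym/eqP; rewrite (negPf h).
Qed.

(* The algebra D: expressions in the generators, modulo the least congruence
   containing the axioms of k-algebras and the defining relations. *)
Section Double.
Variable k : fieldType.

Definition sgn (g : 'S_3) : k := (-1) ^+ odd_perm g.

Inductive dterm : Type :=
| Tx of transp
| Ty of transp
| Tg of 'S_3
| Td of 'S_3
| T0
| T1
| Topp of dterm
| Tadd of dterm & dterm
| Tmul of dterm & dterm
| Tscale of k & dterm.

Declare Scope dterm_scope.
Delimit Scope dterm_scope with D.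
Bind Scope dterm_scope with dterm.
Local Notation "0" := T0 : dterm_scope.
Local Notation "1" := T1 : dterm_scope.
Local Notation "- a" := (Topp a) : dterm_scope.
Local Notation "a + b" := (Tadd a b) : dterm_scope.
Local Notation "a - b" := (Tadd a (Topp b)) : dterm_scope.
Local Notation "a * b" := (Tmul a b) : dterm_scope.
Local Notation "c *: a" := (Tscale c a) : dterm_scope.
Local Notation "''x_' t" := (Tx t) (at level 8, t at level 2) : dterm_scope.
Local Notation "''y_' t" := (Ty t) (at level 8, t at level 2) : dterm_scope.
Local Notation "''g_' g" := (Tg g) (at level 8, g at level 2) : dterm_scope.
Local Notation "''d_' h" := (Td h) (at level 8, h at level 2) : dterm_scope.
Local Open Scope dterm_scope.

(* For hij : i != j, [tp hij] is the transposition (ij). *)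
Inductive drel : dterm -> dterm -> Prop :=
| rel_g1 : drel 'g_(1%g) 1
| rel_gg g h : drel ('g_g * 'g_h) 'g_(g ∘∘ h)
| rel_dd g h : drel ('d_g * 'd_h) (if g == h then 'd_g else 0)
| rel_d1 : drel (\big[Tadd/T0]_(h : 'S_3) 'd_h) 1
| rel_dg g h : drel ('d_h * 'g_g) ('g_g * 'd_(h ^ g^-1)%g)
| rel_xx t : drel ('x_t * 'x_t) 0
| rel_xxx i j l (hij : i != j) (hil : i != l) (hjl : j != l) :
    drel ('x_(tp hij) * 'x_(tp hil) + 'x_(tp hjl) * 'x_(tp hij)
          + 'x_(tp hil) * 'x_(tp hjl)) 0
| rel_yy t : drel ('y_t * 'y_t) 0
| rel_yyy i j l (hij : i != j) (hil : i != l) (hjl : j != l) :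
    drel ('y_(tp hij) * 'y_(tp hil) + 'y_(tp hjl) * 'y_(tp hij)
          + 'y_(tp hil) * 'y_(tp hjl)) 0
| rel_gx g t : drel ('g_g * 'x_t) (sgn g *: ('x_(transpJ g t) * 'g_g))
| rel_dx h t : drel ('d_h * 'x_t) ('x_t * 'd_(val t ∘∘ h))
| rel_dy h t : drel ('d_h * 'y_t) ('y_t * 'd_(val t ∘∘ h))
| rel_yg g t : drel ('y_t * 'g_g) (sgn g *: ('g_g * 'y_(transpJ g^-1 t)))
| rel_yx t :
    drel ('y_t * 'x_t + 'x_t * 'y_t) (1 + 'g_(val t) * ('d_(val t) - 'd_(1%g)))
| rel_yxx i j l (hij : i != j) (hil : i != l) (hjl : j != l) :
    drel ('y_(tp hil) * 'x_(tp hij) + 'x_(tp hij) * 'y_(tp hjl))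
         ('g_(tperm i j) * ('d_(tperm i l) - 'd_(tperm i l ∘∘ tperm i j))).

Inductive dcong : dterm -> dterm -> Prop :=
| dc_rel a b : drel a b -> dcong a b
| dc_refl a : dcong a a
| dc_sym a b : dcong a b -> dcong b a
| dc_trans a b c : dcong a b -> dcong b c -> dcong a c
| dc_opp a a' : dcong a a' -> dcong (- a) (- a')
| dc_add a a' b b' : dcong a a' -> dcong b b' -> dcong (a + b) (a' + b')
| dc_mul a a' b b' : dcong a a' -> dcong b b' -> dcong (a * b) (a' * b')
| dc_scale c a a' : dcong a a' -> dcong (c *: a) (c *: a')
| dc_addA a b c : dcong (a + (b + c)) (a + b + c)
| dc_addC a b : dcong (a + b) (b + a)
| dc_add0 a : dcong (0 + a) a
| dc_addN a : dcong (- a + a) 0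
| dc_mulA a b c : dcong (a * (b * c)) (a * b * c)
| dc_mul1l a : dcong (1 * a) a
| dc_mul1r a : dcong (a * 1) a
| dc_mulDl a b c : dcong ((a + b) * c) (a * c + b * c)
| dc_mulDr a b c : dcong (a * (b + c)) (a * b + a * c)
| dc_scaleA c d a : dcong (c *: (d *: a)) ((c * d)%R *: a)
| dc_scale1 a : dcong (1%R *: a) a
| dc_scaleDr c a b : dcong (c *: (a + b)) (c *: a + c *: b)
| dc_scaleDl c d a : dcong ((c + d)%R *: a) (c *: a + d *: a)
| dc_scaleAl c a b : dcong (c *: (a * b)) ((c *: a) * b)
| dc_scaleAr c a b : dcong (c *: (a * b)) (a * (c *: b)).

Local Close Scope dterm_scope.

HB.instance Definition _ := gen_eqMixin dterm.
HB.instance Definition _ := gen_choiceMixin dterm.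

Definition dcongb (a b : dterm) : bool := `[< dcong a b >].

Lemma dcongb_equiv : equiv_class_of dcongb.
Proof.
split.
- by move=> a; apply/asboolP; exact: dc_refl.
- by move=> a b; apply/asboolP/asboolP; exact: dc_sym.
- move=> b a c /asboolP hab /asboolP hbc; apply/asboolP.
  exact: dc_trans hab hbc.
Qed.

Canonical dcongb_equivRel := EquivRelPack dcongb_equiv.
Canonical dcongb_encModRel := defaultEncModRel dcongb.

Definition fkdouble := {eq_quot dcongb}.
HB.instance Definition _ := Choice.on fkdouble.

Definition dpi (a : dterm) : fkdouble := \pi_({eq_quot dcongb}) a.

Lemma dpiP a b : dpi a = dpi b <-> dcong a b.
Proof.
split=> [/eqP|h]; last by apply/eqP; rewrite /dpi piE; apply/asboolP.
by rewrite /dpi piE => /asboolP.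
Qed.

Lemma dreprK (a : fkdouble) : dpi (repr a) = a.
Proof. exact: reprK. Qed.

Lemma drepr_pi a : dcong (repr (dpi a)) a.
Proof. by apply/dpiP; rewrite dreprK. Qed.

Definition dadd (a b : fkdouble) : fkdouble := dpi (Tadd (repr a) (repr b)).
Definition dopp (a : fkdouble) : fkdouble := dpi (Topp (repr a)).
Definition dmul (a b : fkdouble) : fkdouble := dpi (Tmul (repr a) (repr b)).
Definition dscale (c : k) (a : fkdouble) : fkdouble := dpi (Tscale c (repr a)).

Lemma dadd_pi a b : dadd (dpi a) (dpi b) = dpi (Tadd a b).
Proof. by apply/dpiP; apply: dc_add; exact: drepr_pi. Qed.
Lemma dopp_pi a : dopp (dpi a) = dpi (Topp a).
Proof. by apply/dpiP; apply: dc_opp; exact: drepr_pi. Qed.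
Lemma dmul_pi a b : dmul (dpi a) (dpi b) = dpi (Tmul a b).
Proof. by apply/dpiP; apply: dc_mul; exact: drepr_pi. Qed.
Lemma dscale_pi c a : dscale c (dpi a) = dpi (Tscale c a).
Proof. by apply/dpiP; apply: dc_scale; exact: drepr_pi. Qed.

Definition dpiE := (dadd_pi, dopp_pi, dmul_pi, dscale_pi).

Lemma daddA : associative dadd.
Proof.
move=> a b c; rewrite -[a]dreprK -[b]dreprK -[c]dreprK !dpiE.
by apply/dpiP; exact: dc_addA.
Qed.
Lemma daddC : commutative dadd.
Proof.
move=> a b; rewrite -[a]dreprK -[b]dreprK !dpiE.
by apply/dpiP; exact: dc_addC.
Qed.
Lemma dadd0 : left_id (dpi T0) dadd.
Proof. by move=> a; rewrite -[a]dreprK !dpiE; apply/dpiP; exact: dc_add0. Qed.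
Lemma daddN : left_inverse (dpi T0) dopp dadd.
Proof. by move=> a; rewrite -[a]dreprK !dpiE; apply/dpiP; exact: dc_addN. Qed.

HB.instance Definition _ :=
  GRing.isZmodule.Build fkdouble daddA daddC dadd0 daddN.

Lemma dpiD a b : dpi (Tadd a b) = dpi a + dpi b.
Proof. by rewrite -dadd_pi. Qed.

Lemma dmulA : associative dmul.
Proof.
move=> a b c; rewrite -[a]dreprK -[b]dreprK -[c]dreprK !dpiE.
by apply/dpiP; exact: dc_mulA.
Qed.
Lemma dmul1l : left_id (dpi T1) dmul.
Proof. by move=> a; rewrite -[a]dreprK !dpiE; apply/dpiP; exact: dc_mul1l. Qed.
Lemma dmul1r : right_id (dpi T1) dmul.
Proof. by move=> a; rewrite -[a]dreprK !dpiE; apply/dpiP; exact: dc_mul1r. Qed.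
Lemma dmulDl : left_distributive dmul +%R.
Proof.
move=> a b c; rewrite -[a]dreprK -[b]dreprK -[c]dreprK -dpiD !dpiE -dpiD.
by apply/dpiP; exact: dc_mulDl.
Qed.
Lemma dmulDr : right_distributive dmul +%R.
Proof.
move=> a b c; rewrite -[a]dreprK -[b]dreprK -[c]dreprK -dpiD !dpiE -dpiD.
by apply/dpiP; exact: dc_mulDr.
Qed.

(* The counit of D, used only to see that 1 != 0. *)
Fixpoint dcounit (a : dterm) : k :=
  match a with
  | Tx _ | Ty _ | T0 => 0
  | Tg _ | T1 => 1
  | Td h => (h == 1%g)%:R
  | Topp a => - dcounit a
  | Tadd a b => dcounit a + dcounit b
  | Tmul a b => dcounit a * dcounit b
  | Tscale c a => c * dcounit a
  end.

Lemma dcounit_rel a b : drel a b -> dcounit a = dcounit b.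
Proof.
case=> /=; do ?by move=> *; rewrite ?(mulr0, mul0r, addr0, mulr1).
- move=> g h; have [<-|ngh] /= := eqVneq g h.
    by case: (g == 1%g) => /=; rewrite ?mulr0 ?mulr1.
  have [g1|] := eqVneq g 1%g; last by rewrite mul0r.
  by rewrite g1 eq_sym in ngh; rewrite (negPf ngh) mulr0.
- rewrite (big_morph dcounit (id1 := 0) (op1 := +%R)) //=.
  by rewrite (bigD1 1%g) //= eqxx big1 ?addr0 // => h /negPf ->.
- move=> g h; rewrite mulr1 mul1r -[in RHS](conj1g g^-1)%g.
  by rewrite (inj_eq (@conjg_inj _ _)).
- by move=> t; rewrite transp_neq1 eqxx sub0r mul1r mulr0 addr0 subrr.
- move=> i j l hij hil hjl; rewrite !mul0r addr0 mul1r.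
  have := transp_neq1 (tp hil) => /= ->.
  case: eqP => [h|]; last by rewrite subrr.
  have /(congr1 (fun p : 'S_3 => p j)) := h.
  by rewrite permM tpermR tpermL perm1 => /esym/eqP; rewrite (negPf hjl).
Qed.

Lemma dcounit_cong a b : dcong a b -> dcounit a = dcounit b.
Proof.
elim=> //=; try by move=> *; congruence.
- exact: dcounit_rel.
- by move=> *; rewrite addrA.
- by move=> *; rewrite addrC.
- by move=> *; rewrite add0r.
- by move=> *; rewrite addNr.
- by move=> *; rewrite mulrA.
- by move=> *; rewrite mul1r.
- by move=> *; rewrite mulr1.
- by move=> *; rewrite mulrDl.
- by move=> *; rewrite mulrDr.
- by move=> *; rewrite mulrA.
- by move=> *; rewrite mul1r.
- by move=> *; rewrite mulrDr.
- by move=> *; rewrite mulrDl.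
- by move=> *; rewrite mulrA.
- by move=> *; rewrite mulrCA.
Qed.

Lemma done_neq0 : dpi T1 != 0.
Proof.
apply/eqP => /dpiP /dcounit_cong /= /eqP; by rewrite oner_eq0.
Qed.

HB.instance Definition _ := GRing.Zmodule_isNzRing.Build fkdouble
  dmulA dmul1l dmul1r dmulDl dmulDr done_neq0.


Lemma dscaleA c d (a : fkdouble) : dscale c (dscale d a) = dscale (c * d) a.
Proof. by rewrite -[a]dreprK !dpiE; apply/dpiP; exact: dc_scaleA. Qed.
Lemma dscale1 : left_id 1 dscale.
Proof. by move=> a; rewrite -[a]dreprK !dpiE; apply/dpiP; exact: dc_scale1. Qed.
Lemma dscaleDr : right_distributive dscale +%R.
Proof.
move=> c a b; rewrite -[a]dreprK -[b]dreprK -dpiD !dpiE -dpiD.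
by apply/dpiP; exact: dc_scaleDr.
Qed.
Lemma dscaleDl (a : fkdouble) : {morph dscale^~ a : c d / c + d}.
Proof.
move=> c d; rewrite -[a]dreprK !dpiE -dpiD.
by apply/dpiP; exact: dc_scaleDl.
Qed.

HB.instance Definition _ := GRing.Zmodule_isLmodule.Build k fkdouble
  dscaleA dscale1 dscaleDr dscaleDl.

Lemma dscaleAl (c : k) (a b : fkdouble) : c *: (a * b) = (c *: a) * b.
Proof.
suff : dscale c (dmul a b) = dmul (dscale c a) b by [].
rewrite -[a]dreprK -[b]dreprK !dpiE; apply/dpiP; exact: dc_scaleAl.
Qed.

HB.instance Definition _ := GRing.Lmodule_isLalgebra.Build k fkdouble dscaleAl.

Lemma dscaleAr (c : k) (a b : fkdouble) : c *: (a * b) = a * (c *: b).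
Proof.
suff : dscale c (dmul a b) = dmul a (dscale c b) by [].
rewrite -[a]dreprK -[b]dreprK !dpiE; apply/dpiP; exact: dc_scaleAr.
Qed.

HB.instance Definition _ := GRing.Lalgebra_isAlgebra.Build k fkdouble dscaleAr.

Definition dx (t : transp) : fkdouble := dpi (Tx t).
Definition dy (t : transp) : fkdouble := dpi (Ty t).
Definition dg (g : 'S_3) : fkdouble := dpi (Tg g).
Definition dd (h : 'S_3) : fkdouble := dpi (Td h).

(* Modules over the subalgebra D(S_3) generated by the g and the delta_h. *)
Record ds3mod := DS3Mod {
  ds3_sort :> lmodType k;
  actg : 'S_3 -> {linear ds3_sort -> ds3_sort};
  actd : 'S_3 -> {linear ds3_sort -> ds3_sort};
  actg1 : forall m, actg 1%g m = m;
  actgM : forall g h m, actg (g ∘∘ h) m = actg g (actg h m);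
  actdd : forall g h m, actd g (actd h m) = if g == h then actd g m else 0;
  actd1 : forall m, \sum_(h : 'S_3) actd h m = m;
  actdg : forall g h m, actd h (actg g m) = actg g (actd (h ^ g^-1)%g m)
}.

Section MePlus.

Definition ep_actg (g : 'S_3) (m : k^o) : k^o := m.
Definition ep_actd (h : 'S_3) (m : k^o) : k^o := if h == 1%g then m else 0.

Lemma ep_actg_linear g : linear (ep_actg g).
Proof. by []. Qed.
Lemma ep_actd_linear h : linear (ep_actd h).
Proof.
by move=> c u v; rewrite /ep_actd; case: ifP => // _; rewrite scaler0 addr0.
Qed.

HB.instance Definition _ g :=
  GRing.isLinear.Build k k^o k^o *:%R (ep_actg g) (ep_actg_linear g).
HB.instance Definition _ h :=
  GRing.isLinear.Build k k^o k^o *:%R (ep_actd h) (ep_actd_linear h).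

Lemma ep_actdd g h m :
  ep_actd g (ep_actd h m) = if g == h then ep_actd g m else 0.
Proof.
rewrite /ep_actd; have [->|ngh] := eqVneq g h; first by case: (h == 1%g).
have [g1|//] := eqVneq g 1%g.
by rewrite g1 eq_sym in ngh; rewrite (negPf ngh).
Qed.

Lemma ep_actd1 m : \sum_(h : 'S_3) ep_actd h m = m.
Proof.
by rewrite /ep_actd (bigD1 1%g) //= eqxx big1 ?addr0 // => h /negPf ->.
Qed.

Lemma ep_actdg g h m :
  ep_actd h (ep_actg g m) = ep_actg g (ep_actd (h ^ g^-1)%g m).
Proof.
rewrite /ep_actd /ep_actg -[in RHS](conj1g g^-1)%g.
by rewrite (inj_eq (@conjg_inj _ _)).
Qed.

(* M(e,+): the trivial g-action, in degree e *)
Definition Mod_e_plus : ds3mod :=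
  @DS3Mod k^o (fun g => ep_actg g) (fun h => ep_actd h)
    (fun=> erefl) (fun _ _ _ => erefl) ep_actdd ep_actd1 ep_actdg.
End MePlus.

Section MSigmaMinus.

(* M(sigma,-): f stands for the sum of the f t |t>, so the coefficient of |t> in g.f is
   sgn(g) times the coefficient of |g^-1 t g> in f. *)
Definition sm_actg (g : 'S_3) (f : {ffun transp -> k^o}) : {ffun transp -> k^o} :=
  [ffun t => sgn g * f (transpJ g^-1 t)].
Definition sm_actd (h : 'S_3) (f : {ffun transp -> k^o}) : {ffun transp -> k^o} :=
  [ffun t => if val t == h then f t else 0].

Lemma sm_actg_linear g : linear (sm_actg g).
Proof. by move=> c u v; apply/ffunP => t; rewrite !ffunE mulrDr mulrCA. Qed.
Lemma sm_actd_linear h : linear (sm_actd h).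
Proof.
move=> c u v; apply/ffunP => t; rewrite !ffunE.
by case: ifP => // _; rewrite scaler0 addr0.
Qed.

HB.instance Definition _ g := GRing.isLinear.Build k
  {ffun transp -> k^o} {ffun transp -> k^o} *:%R (sm_actg g) (sm_actg_linear g).
HB.instance Definition _ h := GRing.isLinear.Build k
  {ffun transp -> k^o} {ffun transp -> k^o} *:%R (sm_actd h) (sm_actd_linear h).

Lemma sm_actg1 f : sm_actg 1%g f = f.
Proof.
apply/ffunP => t; rewrite ffunE /sgn odd_perm1 expr0 mul1r; congr (f _).
by apply/val_inj; rewrite /= invg1 conjg1.
Qed.

Lemma sm_actgM g h f : sm_actg (g ∘∘ h) f = sm_actg g (sm_actg h f).
Proof.
apply/ffunP => t; rewrite !ffunE mulrA /sgn odd_permM signr_addb [X in X * _]mulrC.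
congr (_ * f _); apply/val_inj; by rewrite /= invMg conjgM.
Qed.

Lemma sm_actdd g h f :
  sm_actd g (sm_actd h f) = if g == h then sm_actd g f else 0.
Proof.
apply/ffunP => t; rewrite !ffunE; have [->|ngh] := eqVneq g h; rewrite !ffunE.
  by case: (val t == h).
by have [->|//] := eqVneq (val t) g; rewrite (negPf ngh).
Qed.

Lemma sm_actd1 f : \sum_(h : 'S_3) sm_actd h f = f.
Proof.
apply/ffunP => t; rewrite sum_ffunE (bigD1 (val t)) //= ffunE eqxx.
by rewrite big1 ?addr0 // => h; rewrite ffunE eq_sym => /negPf ->.
Qed.

Lemma sm_actdg g h f :
  sm_actd h (sm_actg g f) = sm_actg g (sm_actd (h ^ g^-1)%g f).
Proof.
apply/ffunP => t; rewrite !ffunE /= (inj_eq (@conjg_inj _ _)).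
by case: ifP => // _; rewrite mulr0.
Qed.

Definition Mod_sigma_minus : ds3mod :=
  @DS3Mod {ffun transp -> k^o} (fun g => sm_actg g) (fun h => sm_actd h)
    sm_actg1 sm_actgM sm_actdd sm_actd1 sm_actdg.
End MSigmaMinus.

(* "a lies in the subalgebra D^{>=0} generated by D(S_3) and the y_t, and acts
   on M as f", where the y_t act on M by 0. *)
Inductive ge0_act (M : ds3mod) : fkdouble -> (M -> M) -> Prop :=
| ge0_g g : ge0_act (dg g) (actg M g)
| ge0_d h : ge0_act (dd h) (actd M h)
| ge0_y t : ge0_act (dy t) (fun=> 0)
| ge0_1 : ge0_act 1 id
| ge0_add a b f f' : ge0_act a f -> ge0_act b f' ->
    ge0_act (a + b) (fun m => f m + f' m)
| ge0_mul a b f f' : ge0_act a f -> ge0_act b f' ->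
    ge0_act (a * b) (fun m => f (f' m))
| ge0_scale c a f : ge0_act a f -> ge0_act (c *: a) (fun m => c *: f m).

(* The Verma module: the tensor product of fkdouble and M over D^{>=0}, as formal
   sums of pure tensors modulo the least congruence making the pure tensors
   biadditive and balanced over D^{>=0} (hence over k). *)
Section Verma.
Variable M : ds3mod.

Inductive vterm : Type :=
| Vpure of fkdouble & M
| V0
| Vopp of vterm
| Vadd of vterm & vterm.

Inductive vcong : vterm -> vterm -> Prop :=
| vc_refl u : vcong u u
| vc_sym u v : vcong u v -> vcong v u
| vc_trans u v w : vcong u v -> vcong v w -> vcong u w
| vc_opp u u' : vcong u u' -> vcong (Vopp u) (Vopp u')
| vc_add u u' v v' : vcong u u' -> vcong v v' -> vcong (Vadd u v) (Vadd u' v')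
| vc_addA u v w : vcong (Vadd u (Vadd v w)) (Vadd (Vadd u v) w)
| vc_addC u v : vcong (Vadd u v) (Vadd v u)
| vc_add0 u : vcong (Vadd V0 u) u
| vc_addN u : vcong (Vadd (Vopp u) u) V0
| vc_pureDl a b m : vcong (Vpure (a + b) m) (Vadd (Vpure a m) (Vpure b m))
| vc_pureDr a m m' : vcong (Vpure a (m + m')) (Vadd (Vpure a m) (Vpure a m'))
| vc_balanced a b f m : ge0_act b f ->
    vcong (Vpure (a * b) m) (Vpure a (f m)).

HB.instance Definition _ := gen_eqMixin vterm.
HB.instance Definition _ := gen_choiceMixin vterm.

Definition vcongb (u v : vterm) : bool := `[< vcong u v >].

Lemma vcongb_equiv : equiv_class_of vcongb.
Proof.
split.
- by move=> u; apply/asboolP; exact: vc_refl.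
- by move=> u v; apply/asboolP/asboolP; exact: vc_sym.
- move=> v u w /asboolP huv /asboolP hvw; apply/asboolP.
  exact: vc_trans huv hvw.
Qed.

Canonical vcongb_equivRel := EquivRelPack vcongb_equiv.
Canonical vcongb_encModRel := defaultEncModRel vcongb.

Definition verma := {eq_quot vcongb}.
HB.instance Definition _ := Choice.on verma.

Definition vpi (u : vterm) : verma := \pi_({eq_quot vcongb}) u.

Lemma vpiP u v : vpi u = vpi v <-> vcong u v.
Proof.
split=> [/eqP|h]; last by apply/eqP; rewrite /vpi piE; apply/asboolP.
by rewrite /vpi piE => /asboolP.
Qed.

Lemma vreprK (u : verma) : vpi (repr u) = u.
Proof. exact: reprK. Qed.

Lemma vrepr_pi u : vcong (repr (vpi u)) u.
Proof. by apply/vpiP; rewrite vreprK. Qed.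

Definition vadd (u v : verma) : verma := vpi (Vadd (repr u) (repr v)).
Definition vopp (u : verma) : verma := vpi (Vopp (repr u)).

Lemma vadd_pi u v : vadd (vpi u) (vpi v) = vpi (Vadd u v).
Proof. by apply/vpiP; apply: vc_add; exact: vrepr_pi. Qed.
Lemma vopp_pi u : vopp (vpi u) = vpi (Vopp u).
Proof. by apply/vpiP; apply: vc_opp; exact: vrepr_pi. Qed.

Definition vpiE := (vadd_pi, vopp_pi).

Lemma vaddA : associative vadd.
Proof.
move=> u v w; rewrite -[u]vreprK -[v]vreprK -[w]vreprK !vpiE.
by apply/vpiP; exact: vc_addA.
Qed.
Lemma vaddC : commutative vadd.
Proof.
move=> u v; rewrite -[u]vreprK -[v]vreprK !vpiE.
by apply/vpiP; exact: vc_addC.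
Qed.
Lemma vadd0 : left_id (vpi V0) vadd.
Proof. by move=> u; rewrite -[u]vreprK !vpiE; apply/vpiP; exact: vc_add0. Qed.
Lemma vaddN : left_inverse (vpi V0) vopp vadd.
Proof. by move=> u; rewrite -[u]vreprK !vpiE; apply/vpiP; exact: vc_addN. Qed.

HB.instance Definition _ :=
  GRing.isZmodule.Build verma vaddA vaddC vadd0 vaddN.

Lemma vpiD u v : vpi (Vadd u v) = vpi u + vpi v.
Proof. by rewrite -vadd_pi. Qed.

Fixpoint vtscale (a : fkdouble) (u : vterm) : vterm :=
  match u with
  | Vpure b m => Vpure (a * b) m
  | V0 => V0
  | Vopp u => Vopp (vtscale a u)
  | Vadd u v => Vadd (vtscale a u) (vtscale a v)
  end.

Lemma vtscale_cong a u v : vcong u v -> vcong (vtscale a u) (vtscale a v).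
Proof.
elim=> /=.
- by move=> w; exact: vc_refl.
- by move=> w w' _; exact: vc_sym.
- by move=> w w' w'' _ h _; exact: vc_trans.
- by move=> w w' _; exact: vc_opp.
- by move=> w w' z z' _ h _; exact: vc_add.
- by move=> *; exact: vc_addA.
- by move=> *; exact: vc_addC.
- by move=> *; exact: vc_add0.
- by move=> *; exact: vc_addN.
- by move=> b c m; rewrite mulrDr; exact: vc_pureDl.
- by move=> *; exact: vc_pureDr.
- by move=> b c f m h; rewrite mulrA; exact: vc_balanced.
Qed.

Definition vscale (a : fkdouble) (u : verma) : verma := vpi (vtscale a (repr u)).

Lemma vscale_pi a u : vscale a (vpi u) = vpi (vtscale a u).
Proof. by apply/vpiP; apply: vtscale_cong; exact: vrepr_pi. Qed.

Lemma vscaleA a b u : vscale a (vscale b u) = vscale (a * b) u.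
Proof.
rewrite -[u]vreprK !vscale_pi; congr vpi.
by elim: (repr u) => //= [c m|v ->|v -> w ->] //; rewrite mulrA.
Qed.

Lemma vscale1 : left_id 1 vscale.
Proof.
move=> u; rewrite -[u]vreprK vscale_pi; congr vpi.
by elim: (repr u) => //= [c m|v ->|v -> w ->] //; rewrite mul1r.
Qed.

Lemma vscaleDr : right_distributive vscale +%R.
Proof.
move=> a u v; rewrite -[u]vreprK -[v]vreprK -vpiD !vscale_pi.
by rewrite -vpiD.
Qed.

Lemma vscaleDl u : {morph vscale^~ u : a b / a + b}.
Proof.
move=> a b; rewrite -[u]vreprK !vscale_pi.
have piN w : vpi (Vopp w) = - vpi w by rewrite -vopp_pi.
elim: (repr u) => /= [c m||v IHv|v IHv w IHw].
- by rewrite mulrDl -vpiD; apply/vpiP; exact: vc_pureDl.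
- by rewrite -vpiD; apply/vpiP/vc_sym/vc_add0.
- by rewrite !piN IHv opprD.
- by rewrite !vpiD IHv IHw addrACA.
Qed.

HB.instance Definition _ := GRing.Zmodule_isLmodule.Build fkdouble verma
  vscaleA vscale1 vscaleDr vscaleDl.

Definition vtens (a : fkdouble) (m : M) : verma := vpi (Vpure a m).

(* B^n(V) (x) M, the component of degree -n: B^n(V) is spanned by the products
   of n generators x_t. *)
Definition vdeg (n : nat) (v : verma) : Prop :=
  exists f : n.-tuple transp -> M,
    v = \sum_(w : n.-tuple transp) vtens (\prod_(t <- w) dx t) (f w).

End Verma.

Definition simple_L (M : ds3mod) : lmodType fkdouble := module_head (verma M).

(* The D(S_3)-submodule U of W is isomorphic to M. *)
Definition has_weight (M : ds3mod) (W : lmodType fkdouble) (U : W -> Prop) : Prop :=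
  exists f : M -> W,
    [/\ injective f /\ (forall w, U w <-> exists m, w = f m),
        forall m m', f (m + m') = f m + f m',
        forall (c : k) m, f (c *: m) = (c *: (1 : fkdouble)) *: f m,
        forall g m, f (actg M g m) = dg g *: f m &
        forall h m, f (actd M h m) = dd h *: f m].

Definition highest_weight (M : ds3mod) (W : lmodType fkdouble)
    (N : submodClosed W) : Prop :=
  exists U : W -> Prop,
    [/\ has_weight M U,
        forall t u, U u -> dy t *: u = 0 &
        N =i submod_generated U].

End Double.

(* Main.v *)
(* The monomials 1, x_a, ..., x_a x_b x_a x_c (a = (12), b = (23), c = (13))
   applied to the vacuum span the Verma module V of weight (e,+), because the
   relations of the double move g, delta_h and y_t across the x_t. They are
   independent because V maps onto an explicit 12-dimensional representation,
   whose matrices are forced by the relations and the multiplication table of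
   the x_t and have integer entries. In this basis, projecting a vector to one
   S_3-degree and applying a word in the x_t and y_t extracts any single
   coordinate: a nonzero submodule contains the top degree; one not contained in
   the top degree contains the degree 1, hence all positive degrees; and one with
   a vector of nonzero degree 0 coordinate contains the vacuum. Hence the list of
   submodules.

   The degree 1 vectors are killed by the y_t, so they induce a map from the
   Verma module of weight (sigma,-) onto the simple quotient X/S. A submodule not
   contained in the kernel of that map contains every degree 0 vector up to
   terms of positive degree, hence is everything by Nakayama's lemma, the
   augmentation ideal of the Nichols algebra being nilpotent. So the kernel is
   the unique maximal submodule. *)
From HB Require Import structures.
Require Import Defs.
From mathcomp Require Import all_fingroup all_boot all_algebra.
From mathcomp Require Import boolp.

Set Implicit Arguments.
Unset Strict Implicit.
Unset Printing Implicit Defensive.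

Import GRing.Theory.
Local Open Scope ring_scope.

(** * Submodules and quotients *)

Section Submodules.
Variable R : pzRingType.
Implicit Types U V W : lmodType R.

Lemma mem_generated W (A : W -> Prop) w : A w -> w \in submod_generated A.
Proof. by move=> hw; apply/asboolP => N; apply. Qed.

Lemma generated_min W (A : W -> Prop) (N : submodClosed W) :
  (forall w, A w -> w \in N) -> {subset submod_generated A <= N}.
Proof. by move=> hA w /asboolP; apply. Qed.

Section Closed.
Variables (W : lmodType R) (A : W -> Prop).
Hypotheses (A0 : A 0) (AD : forall u v, A u -> A v -> A (u + v)).
Hypothesis (AZ : forall a v, A v -> A (a *: v)).

Let Apred : {pred W} := fun w => `[< A w >].

Let Apred_closed : GRing.subsemimod_closed Apred.
Proof.
split; first split; first exact/asboolP.
- by move=> u v /asboolP hu /asboolP hv; apply/asboolP; apply: AD.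
- by move=> a v /asboolP hv; apply/asboolP; apply: AZ.
Qed.

Lemma generatedE w : w \in submod_generated A <-> A w.
Proof.
split=> [|hw]; last exact: mem_generated.
pose N : submodClosed W := HB.pack_for (submodClosed W) Apred
  (GRing.isSubmodClosed.Build R W Apred Apred_closed).
have hN u : A u -> u \in N by move=> hu; apply/asboolP.
by move/(generated_min hN)/asboolP.
Qed.
End Closed.

Definition mk_linear U V (f : U -> V) (lin : linear f) : {linear U -> V} :=
  HB.pack_for {linear U -> V} f (GRing.isLinear.Build R U V *:%R f lin).

Lemma mk_linearE U V (f : U -> V) (lin : linear f) : mk_linear lin =1 f.
Proof. by []. Qed.

Lemma quomod_pi_linear W (N : submodClosed W) : linear (quomod_pi N).
Proof. by move=> a u v; rewrite quomod_piD -quomod_scale_pi. Qed.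

Lemma quomod_pi0 W (N : submodClosed W) w : quomod_pi N w = 0 <-> w \in N.
Proof.
have -> : (0 : quomod N) = quomod_pi N 0.
  exact: (esym (linear0 (mk_linear (@quomod_pi_linear W N)))).
by rewrite quomod_piP subr0.
Qed.

Lemma first_isomorphism W (N : submodClosed W) V (f : {linear W -> V}) :
  (forall v, exists w, f w = v) -> (forall w, w \in N <-> f w = 0) ->
  isomorphic (quomod N) V.
Proof.
move=> surj ker.
have fpi w : f (repr (quomod_pi N w)) = f w.
  apply/eqP; rewrite -subr_eq0 -linearB; apply/eqP/ker/quomod_piP.
  exact: quomod_reprK.
pose F (x : quomod N) := f (repr x).
have Flin : linear F.
  move=> a x y; rewrite -[x]quomod_reprK -[y]quomod_reprK.
  by rewrite -quomod_pi_linear /F !fpi linearP.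
exists (mk_linear Flin).
pose G v := quomod_pi N (projT1 (cid (surj v))).
exists G => [x|v] /=.
- rewrite /G; case: cid => w /= hw.
  rewrite -[RHS]quomod_reprK; apply/quomod_piP/ker.
  by rewrite linearB hw subrr.
- by rewrite /F /G; case: cid => w /= hw; rewrite fpi.
Qed.

Lemma isomorphic_sym U V : isomorphic U V -> isomorphic V U.
Proof.
case=> f [g fK gK].
have glin : linear g by exact: can2_linear fK gK.
by exists (mk_linear glin); exists f.
Qed.

Lemma zeroP W (N : submodClosed W) :
  zero_submod N \/ exists2 w, w \in N & w != 0.
Proof.
have [|hN] := EM (exists2 w, w \in N & w != 0); [by right | left].
move=> w hw; apply/eqP; apply: contrapT => hw0; apply: hN; exists w => //.
exact/negP.
Qed.

Lemma unique_maximalP W (K : submodClosed W) :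
  ~ full_submod K ->
  (forall N : submodClosed W, {subset N <= K} \/ full_submod N) ->
  unique_maximal_submod (mod_radical W) /\ mod_radical W =i K.
Proof.
move=> Knf KN.
have Kuniq (N : submodClosed W) : maximal_submod N -> N =i K.
  case=> Nnf Nmax; case: (KN N) => // NK.
  by case: (Nmax K NK) => // KN' w; rewrite KN'.
have Kmax : maximal_submod K.
  split=> // N' KN'; case: (KN N') => [N'K|]; [right | by left].
  by move=> w; apply/idP/idP; [exact: N'K | exact: KN'].
have radE : mod_radical W =i K.
  by move=> w; apply/asboolP/idP => [hw|Kw N /Kuniq ->] //; exact: hw.
split=> //; split=> [|N /Kuniq e w]; last by rewrite e radE.
split=> [h|N hN]; first by apply: Knf => w; rewrite -radE; exact: h.
case: Kmax => _ /(_ N) [w Kw|h|h]; first by apply: hN; rewrite radE.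
  by left.
by right=> w; rewrite h radE.
Qed.

Lemma linear_image_closed U V (f : {linear U -> V}) (N : submodClosed U) v :
  v \in submod_generated (fun v => exists2 u, u \in N & v = f u) <->
  exists2 u, u \in N & v = f u.
Proof.
apply: generatedE.
- by exists 0; rewrite ?rpred0 ?linear0.
- move=> _ _ [u hu ->] [v' hv ->]; exists (u + v'); last by rewrite linearD.
  exact: rpredD.
- move=> a _ [u hu ->]; exists (a *: u); last by rewrite linearZ.
  exact: rpredZ.
Qed.

Lemma linear_preim_closed U V (f : {linear U -> V}) (N : submodClosed V) u :
  u \in submod_generated (fun u => f u \in N) <-> f u \in N.
Proof.
apply: (generatedE (A := fun u => f u \in N)).
- by rewrite linear0 rpred0.
- by move=> u1 u2 h1 h2; rewrite linearD rpredD.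
- by move=> a u1 h1; rewrite linearZ rpredZ.
Qed.

Lemma submod_val_linear W (N : submodClosed W) : linear (@submod_val R W N).
Proof. by []. Qed.

Definition subquo_pi W (A B : submodClosed W) (u : submod A) : subquo A B :=
  quomod_pi _ u.

Lemma subquo_pi_linear W (A B : submodClosed W) : linear (@subquo_pi W A B).
Proof. exact: quomod_pi_linear. Qed.

Lemma subquo_pi0 W (A B : submodClosed W) (u : submod A) :
  subquo_pi B u = 0 <-> submod_val u \in B.
Proof. by rewrite /subquo_pi quomod_pi0. Qed.

Lemma subquo_pi_surj W (A B : submodClosed W) (x : subquo A B) :
  exists u, subquo_pi B u = x.
Proof. by exists (repr x); exact: quomod_reprK. Qed.

Lemma subquo_simple W (A B : submodClosed W) :
  (exists2 w, w \in A & w \notin B) ->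
  (forall N : submodClosed W, (exists2 w, w \in N & w \notin B) ->
    {subset B <= N} -> {subset A <= N}) ->
  simple_module (subquo A B).
Proof.
case=> w0 Aw0 nBw0 hN; split.
  exists (subquo_pi B (Submod Aw0)); apply/eqP => /subquo_pi0 /=.
  by apply/negP.
move=> N; case: (zeroP N) => [|[x Nx x0]]; [by left | right].
pose p := mk_linear (@subquo_pi_linear W A B).
pose N1 := submod_generated (fun u : submod A => p u \in N).
have N1P u : u \in N1 <-> p u \in N by exact: linear_preim_closed.
pose N2 := submod_generated
  (fun w => exists2 u, u \in N1 & w = mk_linear (@submod_val_linear W A) u).
have N2P w : w \in N2 <-> _ := linear_image_closed _ _ w.
have BN2 w : w \in A -> w \in B -> w \in N2.
  move=> Aw Bw; apply/N2P; exists (Submod Aw) => //; apply/N1P.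
  have -> : p (Submod Aw) = 0 by apply/subquo_pi0.
  exact: rpred0.
pose N3 := submod_generated
  (fun w => exists n b, [/\ n \in N2, b \in B & w = n + b]).
have N3P w : w \in N3 <-> exists n b, [/\ n \in N2, b \in B & w = n + b].
  apply: generatedE.
  - by exists 0, 0; rewrite !rpred0 addr0.
  - move=> _ _ [n [b [hn hb ->]]] [n' [b' [hn' hb' ->]]].
    by exists (n + n'), (b + b'); rewrite !rpredD // addrACA.
  - move=> a _ [n [b [hn hb ->]]].
    by exists (a *: n), (a *: b); rewrite !rpredZ // scalerDr.
have AN3 : {subset A <= N3}.
  apply: hN => [|w Bw]; last first.
    by apply/N3P; exists 0, w; rewrite rpred0 add0r.
  have [u hu] := subquo_pi_surj x; exists (submod_val u).
    apply/N3P; exists (submod_val u), 0; rewrite rpred0 addr0; split=> //.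
    by apply/N2P; exists u => //; apply/N1P; rewrite /p /= hu.
  by apply/negP => /subquo_pi0; rewrite hu => x0'; rewrite x0' eqxx in x0.
move=> y; have [u <-] := subquo_pi_surj y.
have /AN3/N3P[n [b [/N2P[u' /N1P hu' ->] hb eu]]] := submod_valP u.
have -> : subquo_pi B u = p u'; last exact: hu'.
apply/eqP; rewrite -subr_eq0; apply/eqP.
have -> : subquo_pi B u - p u' = p (u - u') by rewrite linearB.
by apply/subquo_pi0 => /=; rewrite eu addrAC subrr add0r.
Qed.

End Submodules.

(** * Integer matrices of the representation *)

(* A permutation of {0, 1, 2} is encoded by the list of its values, and the
   transpositions (12), (23), (13) of the paper by the letters 0, 1, 2. *)
Definition mul3 (p q : seq nat) : seq nat := [seq nth 0%N p i | i <- q].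
Definition inv3 (p : seq nat) : seq nat := [seq index i p | i <- iota 0 3].
Definition conj3 (p q : seq nat) : seq nat := mul3 (mul3 p q) (inv3 p).
Definition perms3 : seq (seq nat) :=
  [:: [:: 0; 1; 2]; [:: 1; 2; 0]; [:: 2; 0; 1];
      [:: 1; 0; 2]; [:: 0; 2; 1]; [:: 2; 1; 0]]%N.
Definition id3 : seq nat := iota 0 3.
Definition sgn3 (p : seq nat) : int := if (index p perms3 < 3)%N then 1 else -1.
Definition tr3 (l : nat) : seq nat := nth [::] (drop 3 perms3) l.
Definition letter_of (p : seq nat) : nat := index p (drop 3 perms3).

(* Integer matrices of size 12, as lists of columns. *)
Definition imx := seq (seq int).
Definition ent (A : imx) (i j : nat) : int := nth 0 (nth [::] A j) i.
Definition mkimx (f : nat -> nat -> int) : imx :=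
  mkseq (fun j => mkseq (fun i => f i j) 12) 12.
Definition iapp (A : imx) (v : seq int) : seq int :=
  mkseq (fun i => foldr (fun l s => ent A i l * nth 0 v l + s) 0 (iota 0 12)) 12.
Definition imul (A B : imx) : imx := mkseq (fun j => iapp A (nth [::] B j)) 12.
Definition iadd (A B : imx) : imx := mkimx (fun i j => ent A i j + ent B i j).
Definition iscale (c : int) (A : imx) : imx := mkimx (fun i j => c * ent A i j).
Definition idelta (r c : nat) : imx := mkimx (fun i j => ((i == r) && (j == c))%:R).
Definition imx1 : imx := mkimx (fun i j => (i == j)%:R).
Definition imx0 : imx := mkimx (fun _ _ => 0).

Definition vunit (i : nat) : seq int := mkseq (fun j => (j == i)%:R) 12.
Definition vlin (a : int) (u : seq int) (b : int) (v : seq int) : seq int :=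
  mkseq (fun i => a * nth 0 u i + b * nth 0 v i) 12.

Definition basis_words : seq (seq nat) :=
  [:: [::]; [:: 0]; [:: 1]; [:: 2]; [:: 0; 1]; [:: 1; 0]; [:: 0; 2]; [:: 1; 2];
      [:: 0; 1; 0]; [:: 0; 1; 2]; [:: 1; 0; 2]; [:: 0; 1; 0; 2]]%N.
Definition bword (i : nat) : seq nat := nth [::] basis_words i.

Lemma bword_lt3 i : all (fun l => (l < 3)%N) (bword i).
Proof.
by case: i => [|[|[|[|[|[|[|[|[|[|[|[|i]]]]]]]]]]]] //; rewrite /bword nth_default.
Qed.

Lemma bword_size i : (0 < i < 12)%N -> (0 < size (bword i) <= 4)%N.
Proof. by case/andP; case: i => [|[|[|[|[|[|[|[|[|[|[|[|//]]]]]]]]]]]]. Qed.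

(* Entry i of row l expands x_l times the i-th basis word in the basis, by means
   of x_2 x_0 = - x_0 x_1 - x_1 x_2, x_2 x_1 = - x_1 x_0 - x_0 x_2 and
   x_1 x_0 x_1 = x_0 x_1 x_0. *)
Definition xtable : seq (seq (seq (int * nat))) :=
  let pos n := (1 : int, n) in let neg n := (-1 : int, n) in
  [:: [:: [:: pos 1]; [::]; [:: pos 4]; [:: pos 6]; [::]; [:: pos 8];
          [::]; [:: pos 9]; [::]; [::]; [:: pos 11]; [::]];
      [:: [:: pos 2]; [:: pos 5]; [::]; [:: pos 7]; [:: pos 8]; [::];
          [:: pos 10]; [::]; [::]; [:: pos 11]; [::]; [::]];
      [:: [:: pos 3]; [:: neg 4; neg 7]; [:: neg 5; neg 6]; [::];
          [:: pos 10]; [:: pos 9]; [:: neg 9]; [:: neg 10];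
          [:: neg 11]; [::]; [::]; [::]]]%N.
Definition xcoefs (l i : nat) : seq (int * nat) := nth [::] (nth [::] xtable l) i.
Definition xmat (l : nat) : imx :=
  mkseq (fun i => foldr (fun p v => vlin p.1 (vunit p.2) 1 v) (vunit 12) (xcoefs l i)) 12.

Definition wdeg (w : seq nat) : seq nat := foldr (fun l d => mul3 (tr3 l) d) id3 w.
Definition dmat (p : seq nat) : imx :=
  mkimx (fun i j => ((i == j) && (wdeg (bword j) == p))%:R).

(* The remaining operators on a word l w are forced by their commutation
   relation with x_l and their action on the vacuum. *)
Fixpoint gcol (p w : seq nat) : seq int :=
  if w is l :: w' then
    vlin (sgn3 p) (iapp (xmat (letter_of (conj3 p (tr3 l)))) (gcol p w')) 0 [::]
  else vunit 0.
Definition gmat (p : seq nat) : imx := mkseq (fun j => gcol p (bword j)) 12.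

Definition yxmat (s l : nat) : imx :=
  iadd (if s == l then imx1 else imx0)
    (imul (gmat (tr3 l))
       (iadd (dmat (tr3 s)) (iscale (-1) (dmat (mul3 (tr3 s) (tr3 l)))))).
Fixpoint ycol (s : nat) (w : seq nat) : seq int :=
  if w is l :: w' then
    vlin 1 (iapp (yxmat s l) (vunit (index w' basis_words)))
      (-1) (iapp (xmat l) (ycol (letter_of (conj3 (tr3 l) (tr3 s))) w'))
  else vunit 12.
Definition ymat (s : nat) : imx := mkseq (fun j => ycol s (bword j)) 12.

Definition gtable : seq imx := Eval vm_compute in [seq gmat p | p <- perms3].
Definition dtable : seq imx := Eval vm_compute in [seq dmat p | p <- perms3].
Definition xmatrices : seq imx := Eval vm_compute in [seq xmat l | l <- iota 0 3].
Definition ytable : seq imx := Eval vm_compute in [seq ymat l | l <- iota 0 3].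

Lemma dtableE : dtable = [seq dmat p | p <- perms3].
Proof. by apply/eqP; vm_compute. Qed.

Definition gi (p : seq nat) : imx := nth [::] gtable (index p perms3).
Definition di (p : seq nat) : imx := nth [::] dtable (index p perms3).
Definition xi (l : nat) : imx := nth [::] xmatrices l.
Definition yi (l : nat) : imx := nth [::] ytable l.

Definition lconj (p : seq nat) (l : nat) : nat := letter_of (conj3 p (tr3 l)).

Lemma perms3_eq (A B : seq nat -> imx) :
  all (fun p => A p == B p) perms3 -> {in perms3, A =1 B}.
Proof. by move=> /allP h p /h/eqP. Qed.

Lemma perms3_eq2 (A B : seq nat -> seq nat -> imx) :
  all (fun p => all (fun q => A p q == B p q) perms3) perms3 ->
  {in perms3 &, A =2 B}.
Proof. by move=> /allP h p q /h/allP h' /h'/eqP. Qed.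

Lemma perms3_letter_eq (A B : seq nat -> nat -> imx) :
  all (fun p => all (fun l => A p l == B p l) (iota 0 3)) perms3 ->
  forall p l, p \in perms3 -> (l < 3)%N -> A p l = B p l.
Proof. by move=> /allP h p l /h/allP h' hl; apply/eqP/h'; rewrite mem_iota. Qed.

Lemma letters_eq (A B : nat -> imx) :
  all (fun l => A l == B l) (iota 0 3) -> forall l, (l < 3)%N -> A l = B l.
Proof. by move=> /allP h l hl; apply/eqP/h; rewrite mem_iota. Qed.

Lemma letters_eq2 (A B : nat -> nat -> imx) :
  all (fun s => all (fun t => A s t == B s t) (iota 0 3)) (iota 0 3) ->
  forall s t, (s < 3)%N -> (t < 3)%N -> A s t = B s t.
Proof.
move=> /allP h s t hs ht; have /h/allP h' : s \in iota 0 3 by rewrite mem_iota.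
by apply/eqP/h'; rewrite mem_iota.
Qed.

Lemma gi1 : gi id3 = imx1. Proof. by apply/eqP; vm_compute. Qed.

Lemma giM : {in perms3 &, forall p q, imul (gi p) (gi q) = gi (mul3 p q)}.
Proof. by apply: perms3_eq2; vm_compute. Qed.

Lemma diM : {in perms3 &, forall p q, imul (di p) (di q) = if p == q then di p else imx0}.
Proof. by apply: perms3_eq2; vm_compute. Qed.

Lemma di_sum : foldr iadd imx0 dtable = imx1. Proof. by apply/eqP; vm_compute. Qed.

Lemma di_gi : {in perms3 &, forall p q,
  imul (di q) (gi p) = imul (gi p) (di (conj3 (inv3 p) q))}.
Proof. by apply: perms3_eq2; vm_compute. Qed.

Lemma xi_sqr : forall l, (l < 3)%N -> imul (xi l) (xi l) = imx0.
Proof. by apply: letters_eq; vm_compute. Qed.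

Lemma yi_sqr : forall l, (l < 3)%N -> imul (yi l) (yi l) = imx0.
Proof. by apply: letters_eq; vm_compute. Qed.

Definition quad_sum (M : nat -> imx) (s t : nat) : imx :=
  if s == t then imx0 else
  iadd (iadd (imul (M s) (M t)) (imul (M (lconj (tr3 s) t)) (M s)))
       (imul (M t) (M (lconj (tr3 s) t))).

Lemma xi_quad : forall s t, (s < 3)%N -> (t < 3)%N -> quad_sum xi s t = imx0.
Proof. by apply: letters_eq2; vm_compute. Qed.

Lemma yi_quad : forall s t, (s < 3)%N -> (t < 3)%N -> quad_sum yi s t = imx0.
Proof. by apply: letters_eq2; vm_compute. Qed.

Lemma gi_xi : forall p t, p \in perms3 -> (t < 3)%N ->
  imul (gi p) (xi t) = iscale (sgn3 p) (imul (xi (lconj p t)) (gi p)).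
Proof. by apply: perms3_letter_eq; vm_compute. Qed.

Lemma yi_gi : forall p t, p \in perms3 -> (t < 3)%N ->
  imul (yi t) (gi p) = iscale (sgn3 p) (imul (gi p) (yi (lconj (inv3 p) t))).
Proof. by apply: perms3_letter_eq; vm_compute. Qed.

Lemma di_xi : forall p t, p \in perms3 -> (t < 3)%N ->
  imul (di p) (xi t) = imul (xi t) (di (mul3 (tr3 t) p)).
Proof. by apply: perms3_letter_eq; vm_compute. Qed.

Lemma di_yi : forall p t, p \in perms3 -> (t < 3)%N ->
  imul (di p) (yi t) = imul (yi t) (di (mul3 (tr3 t) p)).
Proof. by apply: perms3_letter_eq; vm_compute. Qed.

Lemma yi_xi : forall s t, (s < 3)%N -> (t < 3)%N ->
  iadd (imul (yi s) (xi t)) (imul (xi t) (yi (lconj (tr3 t) s))) =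
  iadd (if s == t then imx1 else imx0)
    (imul (gi (tr3 t))
       (iadd (di (tr3 s)) (iscale (-1) (di (mul3 (tr3 s) (tr3 t)))))).
Proof. by apply: letters_eq2; vm_compute. Qed.

Definition ixw (w : seq nat) : imx := foldr (fun l A => imul (xi l) A) imx1 w.

Lemma ixw_vacuum i : (i < 12)%N ->
  imul (ixw (bword i)) (idelta 0 0) = iscale 1 (idelta i 0).
Proof.
move=> hi; apply/eqP.
suff /allP h : all (fun i =>
    imul (ixw (bword i)) (idelta 0 0) == iscale 1 (idelta i 0)) (iota 0 12).
  by apply: h; rewrite mem_iota.
by vm_compute.
Qed.

Lemma xcoefs_deg l i : (l < 3)%N -> (i < 12)%N ->
  all (fun p => (p.2 < 12)%N && (size (bword p.2) == (size (bword i)).+1)) (xcoefs l i).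
Proof.
move=> hl hi; suff /allP/(_ l) h : all (fun l => all (fun i => all (fun p =>
    (p.2 < 12)%N && (size (bword p.2) == (size (bword i)).+1)) (xcoefs l i))
    (iota 0 12)) (iota 0 3).
  have /h/allP/(_ i) : l \in iota 0 3 by rewrite mem_iota.
  by apply; rewrite mem_iota.
by vm_compute.
Qed.

(* A generator with matrix A acts by the same scalar c on the quotient by the
   elements of positive degree and on the top degree. *)
Definition extreme_check (A : imx) (c : int) : bool :=
  (imul (idelta 0 0) A == iscale c (idelta 0 0)) &&
  (imul A (idelta 11 11) == iscale c (idelta 11 11)).

Lemma extreme_xy l : (l < 3)%N -> extreme_check (xi l) 0 && extreme_check (yi l) 0.
Proof.
move=> hl; suff /allP h : all (fun l =>
    extreme_check (xi l) 0 && extreme_check (yi l) 0) (iota 0 3).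
  by apply: h; rewrite mem_iota.
by vm_compute.
Qed.

Lemma extreme_gd p : p \in perms3 ->
  extreme_check (gi p) 1 && extreme_check (di p) (p == id3)%:R.
Proof. by move: p; apply/allP; vm_compute. Qed.

Lemma yi_vacuum : forall l, (l < 3)%N ->
  imul (yi l) (idelta 0 0) = iscale 0 (idelta 0 0).
Proof. by apply: letters_eq; vm_compute. Qed.

Lemma gi_vacuum p : p \in perms3 -> imul (gi p) (idelta 0 0) = iscale 1 (idelta 0 0).
Proof. by move: p; apply: perms3_eq; vm_compute. Qed.

Lemma di_vacuum p : p \in perms3 ->
  imul (di p) (idelta 0 0) = iscale (p == id3)%:R (idelta 0 0).
Proof. by move: p; apply: perms3_eq; vm_compute. Qed.

(* A letter (b, l) stands for x_l if b is true and for y_l otherwise. *)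
Definition iop (w : seq (bool * nat)) : imx :=
  foldr (fun p A => imul (if p.1 then xi p.2 else yi p.2) A) imx1 w.

Definition is_pm (A : imx) (r c : nat) : bool :=
  (A == iscale 1 (idelta r c)) || (A == iscale (-1) (idelta r c)).

(* After the projection to the S_3-degree of the i-th basis vector, [to_top]_i
   sends that vector to the top degree and kills all other basis vectors;
   [to_x]_i does the same for the basis vector i + 1, with target the basis vector
   1, which is x_0; [from_x]_i sends the basis vector 1 to the basis vector i + 1.
   All this holds up to signs. *)
Definition to_top : seq (seq (bool * nat)) :=
  let x l := (true, l) in
  [:: [:: x 2; x 0; x 1; x 0]; [:: x 2; x 0; x 1]; [:: x 2; x 1; x 0];
      [:: x 0; x 1; x 0]; [:: x 2; x 1]; [:: x 2; x 0]; [:: x 0; x 1];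
      [:: x 1; x 0]; [:: x 2]; [:: x 1]; [:: x 0]]%N.

Definition to_x : seq (seq (bool * nat)) :=
  let x l := (true, l) in let y l := (false, l) in
  [:: [:: y 1; x 1]; [:: y 1; x 2]; [:: y 2; x 1]; [:: y 1; x 2; y 0]; [:: y 1];
      [:: y 1; x 2; y 2]; [:: y 2]; [:: y 1; y 0]; [:: y 2; y 0];
      [:: y 2; x 1; y 0; y 1]]%N.

Definition from_x : seq (seq (bool * nat)) :=
  let x l := (true, l) in let y l := (false, l) in
  [:: [::]; [:: y 0; x 2]; [:: y 0; x 1]; [:: x 0; y 0; x 2]; [:: x 1];
      [:: x 0; y 0; x 1]; [:: x 1; y 0; x 1]; [:: x 0; x 1]; [:: x 2; x 1];
      [:: x 1; y 0; x 0; x 1]; [:: x 2; x 0; x 1]]%N.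

Definition good_word (w : seq (bool * nat)) : bool := all (fun p => (p.2 < 3)%N) w.

Lemma to_topP i : (i < 11)%N ->
  good_word (nth [::] to_top i) &&
  is_pm (imul (iop (nth [::] to_top i)) (di (wdeg (bword i)))) 11 i.
Proof.
move=> hi; suff /allP h : all (fun i => good_word (nth [::] to_top i) &&
    is_pm (imul (iop (nth [::] to_top i)) (di (wdeg (bword i)))) 11 i) (iota 0 11).
  by apply: h; rewrite mem_iota.
by vm_compute.
Qed.

Lemma to_xP i : (i < 10)%N ->
  good_word (nth [::] to_x i) &&
  is_pm (imul (iop (nth [::] to_x i)) (di (wdeg (bword i.+1)))) 1 i.+1.
Proof.
move=> hi; suff /allP h : all (fun i => good_word (nth [::] to_x i) &&
    is_pm (imul (iop (nth [::] to_x i)) (di (wdeg (bword i.+1)))) 1 i.+1) (iota 0 10).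
  by apply: h; rewrite mem_iota.
by vm_compute.
Qed.

Lemma from_xP i : (i < 11)%N ->
  good_word (nth [::] from_x i) &&
  is_pm (imul (iop (nth [::] from_x i)) (idelta 1 0)) i.+1 0.
Proof.
move=> hi; suff /allP h : all (fun i => good_word (nth [::] from_x i) &&
    is_pm (imul (iop (nth [::] from_x i)) (idelta 1 0)) i.+1 0) (iota 0 11).
  by apply: h; rewrite mem_iota.
by vm_compute.
Qed.

Lemma di1 : di id3 = iadd (idelta 0 0) (idelta 11 11).
Proof. by apply/eqP; vm_compute. Qed.

(** * Permutations of three letters *)

Definition ords3 : seq 'I_3 := [:: ord0; Ordinal (isT : 1 < 3)%N; ord_max].
Definition code (g : 'S_3) : seq nat := [seq (g i : nat) | i <- ords3].

Lemma nth_code g (i : 'I_3) : nth 0%N (code g) i = g i.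
Proof.
by case: i => [[|[|[|//]]] hi] /=; congr (nat_of_ord (g _)); apply: ord_inj.
Qed.

Lemma code_inj : injective code.
Proof. by move=> g h e; apply/perm.permP => i; apply: ord_inj; rewrite -!nth_code e. Qed.

Lemma code_comp g h : code (g ∘∘ h) = mul3 (code g) (code h).
Proof.
by rewrite /code /mul3 -map_comp; apply: eq_map => i /=; rewrite permM nth_code.
Qed.

Lemma mem_code g : code g \in perms3.
Proof.
have : uniq (code g).
  by rewrite map_inj_uniq // => i j /ord_inj/perm_inj.
rewrite /code /=.
by case: (g _) => [[|[|[|//]]] ?]; case: (g _) => [[|[|[|//]]] ?];
   case: (g _) => [[|[|[|//]]] ?].
Qed.

Lemma code1 : code 1%g = id3.
Proof. by rewrite /code /= !perm1. Qed.

Lemma codeV g : code g^-1%g = inv3 (code g).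
Proof.
have e : mul3 (code g) (code g^-1%g) = id3 by rewrite -code_comp mulVg code1.
move: (mem_code g) (mem_code g^-1%g) e; rewrite !inE.
by do 5?[case/orP]; move=> /eqP->; do 5?[case/orP]; move=> /eqP->.
Qed.

Lemma codeJ g h : code (h ^ g)%g = conj3 (code g) (code h).
Proof. by rewrite conjgE !code_comp codeV. Qed.

Lemma tperm_code (i j : 'I_3) :
  code (tperm i j) = [seq (if x == i then j else if x == j then i else x) : nat | x <- ords3].
Proof. by apply: eq_map => x; rewrite permE /=; case: eqP => // _; case: eqP. Qed.

Lemma mem_code_transp (t : transp) : code (val t) \in drop 3 perms3.
Proof.
case: t => s /= /existsP[i /existsP[j /andP[nij /eqP->]]]; rewrite tperm_code.
by case: i nij => [[|[|[|//]]] ?]; case: j => [[|[|[|//]]] ?].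
Qed.

Definition letter (t : transp) : nat := letter_of (code (val t)).

Lemma letter_lt3 t : (letter t < 3)%N.
Proof. by rewrite /letter /letter_of -[3%N]/(size (drop 3 perms3)) index_mem mem_code_transp. Qed.

Lemma tr3_letter t : tr3 (letter t) = code (val t).
Proof. exact: nth_index (mem_code_transp t). Qed.

Lemma letter_inj : injective letter.
Proof. by move=> s t e; apply/val_inj/code_inj; rewrite -!tr3_letter e. Qed.

Lemma letterJ g t : letter (transpJ g t) = lconj (code g) (letter t).
Proof. by rewrite /lconj tr3_letter /letter /= codeJ. Qed.

Definition transp_of (l : nat) : transp :=
  nth (tp (isT : ord0 != ord_max :> 'I_3))
    [:: tp (isT : ord0 != Ordinal (isT : 1 < 3)%N :> 'I_3);
        tp (isT : Ordinal (isT : 1 < 3)%N != ord_max :> 'I_3)] l.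

Lemma transp_ofK l : (l < 3)%N -> letter (transp_of l) = l.
Proof. by case: l => [|[|[|//]]] _; rewrite /letter /= tperm_code. Qed.

Lemma letterK t : transp_of (letter t) = t.
Proof. by apply: letter_inj; rewrite transp_ofK ?letter_lt3. Qed.

Lemma sgn3P (k : fieldType) g : sgn k g = (sgn3 (code g))%:~R.
Proof.
pose s01 : 'S_3 := tperm ord0 (Ordinal (isT : 1 < 3)%N).
pose s12 : 'S_3 := tperm (Ordinal (isT : 1 < 3)%N) ord_max.
have c01 : code s01 = [:: 1; 0; 2]%N by rewrite tperm_code.
have c12 : code s12 = [:: 0; 2; 1]%N by rewrite tperm_code.
have o01 : odd_perm s01 by rewrite odd_tperm.
have o12 : odd_perm s12 by rewrite odd_tperm.
have hs h : code g = code h -> sgn k h = (sgn3 (code h))%:~R ->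
    sgn k g = (sgn3 (code g))%:~R by move=> /code_inj ->.
move: (mem_code g); rewrite !inE => /or3P[|| /or4P[]] /eqP e.
- by apply: (hs 1%g); rewrite code1 ?e // /sgn odd_perm1.
- by apply: (hs (s01 ∘∘ s12)); rewrite code_comp c01 c12 // /sgn odd_permM o01 o12.
- by apply: (hs (s12 ∘∘ s01)); rewrite code_comp c01 c12 // /sgn odd_permM o01 o12.
- by apply: (hs s01); rewrite c01 // /sgn o01.
- by apply: (hs s12); rewrite c12 // /sgn o12.
- by apply: (hs (s01 ∘∘ s12 ∘∘ s01)); rewrite !code_comp c01 c12 // /sgn !odd_permM o01 o12.
Qed.

Lemma transpJ_tp i j l (hij : i != j) (hil : i != l) (hjl : j != l) :
  tp hjl = transpJ (tperm i j) (tp hil).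
Proof.
apply: val_inj => /=; rewrite tpermJ tpermL; congr tperm.
by rewrite tpermD // 1?eq_sym.
Qed.

Lemma tp_neq i j l (hij : i != j) (hil : i != l) (hjl : j != l) : tp hij != tp hil.
Proof.
apply/eqP => /(congr1 (fun t : transp => val t i)) /=; rewrite !tpermL => e.
by rewrite e eqxx in hjl.
Qed.

Lemma transpV (t : transp) : (val t)^-1%g = val t.
Proof. by case: t => s /= /existsP[i /existsP[j /andP[_ /eqP->]]]; rewrite tpermV. Qed.

Lemma transp_mul_eq1 (s t : transp) : (val s ∘∘ val t == 1%g) = (s == t).
Proof. by rewrite -{1}[val s]transpV -eq_mulgV1 -val_eqE eq_sym. Qed.

Lemma transpJ_id (t : transp) : transpJ (val t) t = t.
Proof. by apply: val_inj; rewrite /= conjgE mulKg. Qed.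

Lemma transpJK (g : 'S_3) : cancel (transpJ g) (transpJ g^-1).
Proof. by move=> t; apply: val_inj; rewrite /= conjgK. Qed.

Lemma transp_pair (s t : transp) : s != t ->
  exists i j l (hij : i != j) (hil : i != l) (hjl : j != l),
    s = tp hij /\ t = tp hil.
Proof.
have tpE i j (h h' : i != j) : tp h = tp h' by apply: val_inj.
have tpC i j (h : i != j) (h' : j != i) : tp h = tp h'.
  by apply: val_inj; rewrite /= tpermC.
case: s t => s hs [t ht].
have [i [j [hij es]]] : exists i j (h : i != j), exist is_transp s hs = tp h.
  case/existsP: (hs) => i /existsP[j /andP[h /eqP e]].
  by exists i, j, h; apply: val_inj.
have [i' [j' [hij' et]]] : exists i j (h : i != j), exist is_transp t ht = tp h.
  case/existsP: (ht) => a /existsP[b /andP[h /eqP e]].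
  by exists a, b, h; apply: val_inj.
rewrite es et => nst.
have [e1|n1] := eqVneq i i'.
  subst i'; have [e2|n2] := eqVneq j j'; last by exists i, j, j', hij, hij', n2.
  by subst j'; rewrite (tpE _ _ hij hij') eqxx in nst.
have [e2|n2] := eqVneq i j'.
  subst j'; have hi : i != i' by [].
  have [e3|n3] := eqVneq j i'; last first.
    by exists i, j, i', hij, hi, n3; rewrite (tpC _ _ hi hij').
  by subst i'; rewrite (tpC _ _ hij hij') eqxx in nst.
have hji : j != i by rewrite eq_sym.
have [e3|n3] := eqVneq j i'.
  by subst i'; exists j, i, j', hji, hij', n2; rewrite (tpC _ _ hij hji).
have [e4|n4] := eqVneq j j'.
  subst j'; have hji' : j != i' by [].
  by exists j, i, i', hji, hji', n1; rewrite (tpC _ _ hij hji) (tpC _ _ hij' hji').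
have u : uniq [:: i; j; i'; j'] by rewrite /= !inE !negb_or hij n1 n2 n3 n4 hij'.
by have := max_card (mem [:: i; j; i'; j']); rewrite (card_uniqP u) card_ord.
Qed.

(** * Straightening in the Nichols algebra *)

Section Straightening.
Variables (R : pzRingType) (a b c : R).
Hypotheses (aa : a * a = 0) (bb : b * b = 0) (cc : c * c = 0).
Hypotheses (ab_ca : a * b + c * a + b * c = 0) (ba_cb : b * a + c * b + a * c = 0).

Definition nc_word (w : seq nat) : R := \prod_(l <- w) nth 0 [:: a; b; c] l.

Lemma nc_cons l w : nc_word (l :: w) = nth 0 [:: a; b; c] l * nc_word w.
Proof. exact: big_cons. Qed.

Lemma nc_straighten l i : (l < 3)%N -> (i < 12)%N ->
  nth 0 [:: a; b; c] l * nc_word (bword i) =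
  \sum_(p <- xcoefs l i) p.1%:~R * nc_word (bword p.2).
Proof.
have ca : c * a = - (a * b) - b * c.
  by apply/eqP; rewrite -opprD -addr_eq0 [_ + (a * b + _)]addrCA addrA ab_ca.
have cb : c * b = - (b * a) - a * c.
  by apply/eqP; rewrite -opprD -addr_eq0 [_ + (b * a + _)]addrCA addrA ba_cb.
have aax x : a * (a * x) = 0 by rewrite mulrA aa mul0r.
have bbx x : b * (b * x) = 0 by rewrite mulrA bb mul0r.
have ccx x : c * (c * x) = 0 by rewrite mulrA cc mul0r.
have cax x : c * (a * x) = - (a * (b * x)) - b * (c * x).
  by rewrite mulrA ca mulrBl mulNr !mulrA.
have cbx x : c * (b * x) = - (b * (a * x)) - a * (c * x).
  by rewrite mulrA cb mulrBl mulNr !mulrA.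
have bca x : b * (c * (a * x)) = - (a * (b * (a * x))).
  have := congr1 (fun y => y * (a * x)) ab_ca.
  rewrite !mulrDl mul0r -!mulrA aax mulr0 addr0 => /eqP.
  by rewrite addrC addr_eq0 => /eqP.
have bab x : b * (a * (b * x)) = a * (b * (a * x)).
  by have := bca x; rewrite cax mulrBr mulrN bbx subr0 => /oppr_inj.
have cab x : c * (a * (b * x)) = b * (a * (c * x)).
  by rewrite cax bbx mulr0 oppr0 sub0r cbx mulrBr mulrN bbx oppr0 sub0r opprK.
have cba x : c * (b * (a * x)) = a * (b * (c * x)).
  by rewrite cbx aax mulr0 oppr0 sub0r cax mulrBr mulrN aax oppr0 sub0r opprK.
case: l => [|[|[|//]]] _; case: i => [|[|[|[|[|[|[|[|[|[|[|[|//]]]]]]]]]]]] _;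
  rewrite /xcoefs /bword /= ?big_cons ?big_nil /= !nc_cons /nc_word big_nil /=;
  by rewrite ?(addr0, mul1r, mulN1r, aax, bbx, ccx, bab, cab, cba, cax, cbx,
               mulr0, mulrN, mulrBr, oppr0, subr0, sub0r).
Qed.
End Straightening.

(** * Verma modules *)

Section VermaModule.
Variable k : fieldType.
Local Notation D := (fkdouble k).
Local Notation dx := (@dx k).
Local Notation dy := (@dy k).
Local Notation dg := (@dg k).
Local Notation dd := (@dd k).
Implicit Types (a b : D) (c : k) (t s : transp) (g h : 'S_3).

Definition kmx (A : imx) : 'M[k]_12 := \matrix_(i, j) (ent A i j)%:~R.

Lemma ent_mkimx f (i j : 'I_12) : ent (mkimx f) i j = f i j.
Proof. by rewrite /ent !nth_mkseq. Qed.

Lemma kmxD A B : kmx (iadd A B) = kmx A + kmx B.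
Proof. by apply/matrixP => i j; rewrite !mxE ent_mkimx intrD. Qed.

Lemma kmxZ (c : int) A : kmx (iscale c A) = c%:~R *: kmx A.
Proof. by apply/matrixP => i j; rewrite !mxE ent_mkimx intrM. Qed.

Lemma kmx0 : kmx imx0 = 0.
Proof. by apply/matrixP => i j; rewrite !mxE ent_mkimx. Qed.

Lemma kmx1 : kmx imx1 = 1.
Proof. by apply/matrixP => i j; rewrite !mxE ent_mkimx mulrz_nat. Qed.

Lemma kmxM A B : kmx (imul A B) = kmx A *m kmx B.
Proof.
apply/matrixP => i j; rewrite !mxE /ent /imul nth_mkseq // nth_mkseq //.
transitivity (\sum_(0 <= l < 12) (ent A i l)%:~R * (ent B l j)%:~R : k); last first.
  by rewrite big_mkord; apply: eq_bigr => l _; rewrite !mxE.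
rewrite /index_iota subn0 unlock.
by elim: (iota _ _) => //= l s <-; rewrite intrD intrM.
Qed.

Fixpoint rho_term (a : dterm k) : 'M[k]_12 :=
  match a with
  | Tx t => kmx (xi (letter t))
  | Ty t => kmx (yi (letter t))
  | Tg g => kmx (gi (code g))
  | Td h => kmx (di (code h))
  | T0 => 0
  | T1 => 1
  | Topp a => - rho_term a
  | Tadd a b => rho_term a + rho_term b
  | Tmul a b => rho_term a *m rho_term b
  | Tscale c a => c *: rho_term a
  end.

Lemma rho_quad (M : nat -> imx) :
  (forall s t : nat, (s < 3)%N -> (t < 3)%N -> quad_sum M s t = imx0) ->
  forall i j l (hij : i != j) (hil : i != l) (hjl : j != l),
  let m t := kmx (M (letter t)) in
  m (tp hij) *m m (tp hil) + m (tp hjl) *m m (tp hij) + m (tp hil) *m m (tp hjl) = 0.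
Proof.
move=> quad i j l hij hil hjl /=.
have := quad _ _ (letter_lt3 (tp hij)) (letter_lt3 (tp hil)).
rewrite /quad_sum (inj_eq letter_inj) (negPf (tp_neq hij hil hjl)) tr3_letter -letterJ.
by rewrite /= -(transpJ_tp hij hil hjl) -!kmxM -!kmxD => ->; rewrite kmx0.
Qed.

Lemma rho_yx s t :
  rho_term (Ty k s) *m rho_term (Tx k t) +
    rho_term (Tx k t) *m rho_term (Ty k (transpJ (val t) s)) =
  (if s == t then 1 else 0) +
    rho_term (Tg k (val t)) *m
      (rho_term (Td k (val s)) - rho_term (Td k (val s ∘∘ val t))).
Proof.
have := yi_xi (letter_lt3 s) (letter_lt3 t).
rewrite !tr3_letter -letterJ (inj_eq letter_inj) -code_comp => /(congr1 kmx).
rewrite !(kmxD, kmxM, kmxZ) scaleN1r /= => ->.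
by case: eqP; rewrite ?kmx1 ?kmx0.
Qed.

Lemma rho_rel (a b : dterm k) : drel a b -> rho_term a = rho_term b.
Proof.
case.
- by rewrite /= code1 gi1 kmx1.
- by move=> g h; rewrite /= -kmxM giM ?mem_code // code_comp.
- move=> g h; rewrite /= -kmxM diM ?mem_code // (inj_eq code_inj).
  by case: eqP; rewrite ?kmx0.
- rewrite (big_morph rho_term (id1 := 0) (op1 := +%R)) //=.
  have -> : (1 : 'M[k]_12) = \sum_(A <- dtable) kmx A.
    rewrite -kmx1 -di_sum unlock.
    by elim: dtable => [|A s /= <-]; rewrite ?kmx0 ?kmxD.
  rewrite dtableE big_map.
  pose F p := kmx (dmat p).
  have dE g : kmx (di (code g)) = F (code g).
    by rewrite /di dtableE (nth_map [::]) ?index_mem ?mem_code // nth_index ?mem_code.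
  rewrite (eq_bigr (F \o code)) => [|g _]; last exact: dE.
  rewrite -(big_map code predT F) /index_enum; apply: perm_big.
  have u : uniq [seq code g | g <- enum {: 'S_3}].
    by rewrite map_inj_uniq ?enum_uniq //; exact: code_inj.
  have sub : {subset [seq code g | g <- enum {: 'S_3}] <= perms3}.
    by move=> _ /mapP[g _ ->]; exact: mem_code.
  rewrite perm_sym -enumT; apply: uniq_perm => //.
  have sz : (size perms3 <= size [seq code g | g <- enum {: 'S_3}])%N.
    by rewrite size_map -cardE card_Sn.
  by have [_ e] := uniq_min_size u sub sz; move=> p; rewrite e.
- move=> g h; rewrite /= -!kmxM di_gi ?mem_code //.
  by rewrite codeJ codeV.
- by move=> t; rewrite /= -kmxM xi_sqr ?letter_lt3 // kmx0.
- by move=> *; apply: (rho_quad xi_quad).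
- by move=> t; rewrite /= -kmxM yi_sqr ?letter_lt3 // kmx0.
- by move=> *; apply: (rho_quad yi_quad).
- move=> g t; rewrite /= -!kmxM gi_xi ?mem_code ?letter_lt3 //.
  by rewrite kmxZ sgn3P letterJ.
- by move=> h t; rewrite /= -!kmxM di_xi ?mem_code ?letter_lt3 // tr3_letter code_comp.
- by move=> h t; rewrite /= -!kmxM di_yi ?mem_code ?letter_lt3 // tr3_letter code_comp.
- move=> g t; rewrite /= -!kmxM yi_gi ?mem_code ?letter_lt3 //.
  by rewrite kmxZ sgn3P letterJ codeV.
- move=> t; have := rho_yx t t; rewrite eqxx transpJ_id.
  suff -> : val t ∘∘ val t = 1%g by [].
  by apply/eqP; rewrite transp_mul_eq1.
- move=> i j l hij hil hjl; have := rho_yx (tp hil) (tp hij).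
  rewrite eq_sym (negPf (tp_neq hij hil hjl)) add0r.
  by rewrite -(transpJ_tp hij hil hjl).
Qed.

Lemma dpiM (a b : dterm k) : dpi (Tmul a b) = dpi a * dpi b.
Proof. by rewrite -dmul_pi. Qed.

Lemma dpiN (a : dterm k) : dpi (Topp a) = - dpi a.
Proof. by rewrite -dopp_pi. Qed.

Lemma dpiZ c (a : dterm k) : dpi (Tscale c a) = c *: dpi a.
Proof. by rewrite -dscale_pi. Qed.

Lemma dpi_rel (a b : dterm k) : drel a b -> dpi a = dpi b.
Proof. by move=> r; apply/dpiP; exact: dc_rel. Qed.

Lemma fk_ind (P : D -> Prop) :
  (forall t, P (dx t)) -> (forall t, P (dy t)) ->
  (forall g, P (dg g)) -> (forall h, P (dd h)) -> P 1 ->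
  (forall a b, P a -> P b -> P (a + b)) ->
  (forall a b, P a -> P b -> P (a * b)) ->
  (forall c a, P a -> P (c *: a)) -> forall a, P a.
Proof.
move=> Px Py Pg Pd P1 PD PM PZ a; rewrite -[a]dreprK.
elim: (repr a) => //.
- by rewrite -[dpi _]/(0 : D) -(scale0r 1); apply: PZ.
- by move=> u hu; rewrite dpiN -scaleN1r; apply: PZ.
- by move=> u hu v hv; rewrite dpiD; apply: PD.
- by move=> u hu v hv; rewrite dpiM; apply: PM.
- by move=> c u hu; rewrite dpiZ; apply: PZ.
Qed.

Lemma dx_sqr t : dx t * dx t = 0.
Proof. by rewrite -dpiM (dpi_rel (rel_xx k t)). Qed.

Lemma dx_quad s t : s != t ->
  dx s * dx t + dx (transpJ (val s) t) * dx s + dx t * dx (transpJ (val s) t) = 0.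
Proof.
case/transp_pair=> i [j [l [hij [hil [hjl [-> ->]]]]]].
rewrite -(transpJ_tp hij hil hjl).
by have := dpi_rel (rel_xxx k hij hil hjl); rewrite !(dpiD, dpiM).
Qed.

Lemma dg_dx g t : dg g * dx t = sgn k g *: (dx (transpJ g t) * dg g).
Proof. by rewrite -!dpiM (dpi_rel (rel_gx k g t)) dpiZ. Qed.

Lemma dd_dx h t : dd h * dx t = dx t * dd (val t ∘∘ h).
Proof. by rewrite -!dpiM (dpi_rel (rel_dx k h t)). Qed.

Lemma dy_dx s t : dy s * dx t =
  (if s == t then 1 else 0) + dg (val t) * (dd (val s) - dd (val s ∘∘ val t))
  - dx t * dy (transpJ (val t) s).
Proof.
apply: (addIr (dx t * dy (transpJ (val t) s))); rewrite subrK.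
have [->|] := eqVneq s t.
  have -> : val t ∘∘ val t = 1%g by apply/eqP; rewrite transp_mul_eq1.
  rewrite transpJ_id.
  have := dpi_rel (rel_yx k t).
  by rewrite !(dpiD, dpiM, dpiN).
rewrite eq_sym => /transp_pair[i [j [l [hij [hil [hjl [-> ->]]]]]]].
rewrite -(transpJ_tp hij hil hjl) add0r.
by have := dpi_rel (rel_yxx k hij hil hjl); rewrite !(dpiD, dpiM, dpiN).
Qed.

Definition rho a : 'M[k]_12 := rho_term (repr a).

Lemma rho_cong (a b : dterm k) : dcong a b -> rho_term a = rho_term b.
Proof.
elim=> //=; try by move=> *; congruence.
- exact: rho_rel.
- by move=> *; rewrite addrA.
- by move=> *; rewrite addrC.
- by move=> *; rewrite add0r.
- by move=> *; rewrite addNr.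
- by move=> *; rewrite mulmxA.
- by move=> *; rewrite mul1mx.
- by move=> *; rewrite mulmx1.
- by move=> *; rewrite mulmxDl.
- by move=> *; rewrite mulmxDr.
- by move=> *; rewrite scalerA.
- by move=> *; rewrite scale1r.
- by move=> *; rewrite scalerDr.
- by move=> *; rewrite scalerDl.
- by move=> *; rewrite scalemxAl.
- by move=> *; rewrite scalemxAr.
Qed.

Lemma rho_pi (a : dterm k) : rho (dpi a) = rho_term a.
Proof. exact: rho_cong (drepr_pi a). Qed.

Lemma rhoD a b : rho (a + b) = rho a + rho b.
Proof. by rewrite -[a]dreprK -[b]dreprK -dpiD !rho_pi. Qed.
Lemma rhoM a b : rho (a * b) = rho a *m rho b.
Proof. by rewrite -[a]dreprK -[b]dreprK -dpiM !rho_pi. Qed.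
Lemma rhoZ c a : rho (c *: a) = c *: rho a.
Proof. by rewrite -[a]dreprK -dpiZ !rho_pi. Qed.
Lemma rho1 : rho 1 = 1%:M.
Proof. by rewrite -[1]/(dpi _) rho_pi. Qed.

Definition fkcol := 'cV[k]_12.
HB.instance Definition _ := GRing.Zmodule.on fkcol.
Definition fkcol_scale a (v : fkcol) : fkcol := rho a *m v.

Lemma fkcol_scaleA a b v : fkcol_scale a (fkcol_scale b v) = fkcol_scale (a * b) v.
Proof. by rewrite /fkcol_scale mulmxA rhoM. Qed.
Lemma fkcol_scale1 : left_id 1 fkcol_scale.
Proof. by move=> v; rewrite /fkcol_scale rho1 mul1mx. Qed.
Lemma fkcol_scaleDr : right_distributive fkcol_scale +%R.
Proof. by move=> a u v; exact: mulmxDr. Qed.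
Lemma fkcol_scaleDl v : {morph fkcol_scale^~ v : a b / a + b}.
Proof. by move=> a b; rewrite /fkcol_scale rhoD mulmxDl. Qed.

HB.instance Definition _ := GRing.Zmodule_isLmodule.Build D fkcol
  fkcol_scaleA fkcol_scale1 fkcol_scaleDr fkcol_scaleDl.

Section VermaTheory.
Variable M : ds3mod k.

Lemma vtensDr a (m m' : M) : vtens a (m + m') = vtens a m + vtens a m'.
Proof. by rewrite /vtens -vpiD; apply/vpiP; exact: vc_pureDr. Qed.

Lemma vtens_bal a b f (m : M) : ge0_act b f -> vtens (a * b) m = vtens a (f m).
Proof. by move=> h; apply/vpiP; exact: vc_balanced. Qed.

Lemma scale_vtens a b (m : M) : a *: vtens b m = vtens (a * b) m.
Proof. exact: vscale_pi. Qed.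

Lemma vtensE a (m : M) : vtens a m = a *: vtens 1 m.
Proof. by rewrite scale_vtens mulr1. Qed.

Lemma act_vtens1 b f (m : M) : ge0_act b f -> b *: vtens 1 m = vtens 1 (f m).
Proof. by move=> h; rewrite -vtensE -(vtens_bal _ _ h) mul1r. Qed.

Lemma vtens1Z c (m : M) : vtens 1 (c *: m) = c%:A *: vtens 1 m.
Proof. by rewrite (act_vtens1 _ (ge0_scale c (ge0_1 M))). Qed.

Lemma vtens10 : vtens 1 (0 : M) = 0.
Proof. by apply: (addIr (vtens 1 0)); rewrite -vtensDr !add0r. Qed.

Lemma verma_ind (P : verma M -> Prop) :
  (forall m, P (vtens 1 m)) -> (forall u v, P u -> P v -> P (u + v)) ->
  (forall t u, P u -> P (dx t *: u)) -> forall v, P v.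
Proof.
pose Q u := forall P' : verma M -> Prop,
  (forall m, P' (vtens 1 m)) -> (forall u v, P' u -> P' v -> P' (u + v)) ->
  (forall t u, P' u -> P' (dx t *: u)) -> P' u.
suff QT v : Q v by move=> h1 hD hx v; exact: QT.
have Q1 m : Q (vtens 1 m) by move=> P' h _ _.
have QD u w : Q u -> Q w -> Q (u + w).
  by move=> hu hw P' h1 h2 h3; apply: (h2); [apply: hu | apply: hw].
have Qx t u : Q u -> Q (dx t *: u).
  by move=> hu P' h1 h2 h3; apply: (h3); apply: hu.
have Q0 : Q 0 by rewrite -vtens10.
have QZ c u : Q u -> Q (c%:A *: u).
  move=> hu; apply: (hu (fun u => Q (c%:A *: u))).
  - by move=> m; rewrite -vtens1Z.
  - by move=> u1 u2 h1 h2; rewrite scalerDr; apply: QD.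
  - move=> t u1 h1; rewrite scalerA mulr_algl -[c *: dx t]mulr_algr -scalerA.
    exact: Qx.
have Qg g u : Q u -> Q (dg g *: u).
  move=> hu; apply: (hu (fun u => Q (dg g *: u))).
  - by move=> m; rewrite (act_vtens1 _ (ge0_g M g)).
  - by move=> u1 u2 h1 h2; rewrite scalerDr; apply: QD.
  - move=> t u1 h1; rewrite scalerA dg_dx -mulr_algl -2!scalerA.
    by apply: QZ; apply: Qx.
have Qd u : Q u -> forall h, Q (dd h *: u).
  move=> hu; apply: (hu (fun u => forall h, Q (dd h *: u))).
  - by move=> m h; rewrite (act_vtens1 _ (ge0_d M h)).
  - by move=> u1 u2 h1 h2 h; rewrite scalerDr; apply: QD.
  - by move=> t u1 h1 h; rewrite scalerA dd_dx -scalerA; apply: Qx.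
have QN u : Q u -> Q (- u).
  by move=> hu; rewrite -scaleN1r -scaleN1r; apply: QZ.
have Qy u : Q u -> forall s, Q (dy s *: u).
  move=> hu; suff [] : Q u /\ forall s, Q (dy s *: u) by [].
  refine (hu (fun u => Q u /\ forall s, Q (dy s *: u)) _ _ _).
  - by move=> m; split=> // s; rewrite (act_vtens1 _ (ge0_y M s)).
  - move=> u1 u2 [q1 h1] [q2 h2]; split; first exact: QD.
    by move=> s; rewrite scalerDr; apply: QD.
  - move=> t u1 [q1 h1]; split; first exact: Qx.
    move=> s; rewrite scalerA dy_dx 2!scalerDl scaleNr -!scalerA scalerBl.
    apply: (QD); first apply: (QD).
    + by case: eqP; rewrite ?scale1r ?scale0r.
    + by apply: Qg; apply: QD; [|apply: QN]; apply: Qd.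
    + by apply: QN; apply: Qx.
have Qa a : forall u, Q u -> Q (a *: u).
  elim/fk_ind: a.
  - by move=> t u; apply: Qx.
  - by move=> t u hu; apply: Qy.
  - by move=> g u; apply: Qg.
  - by move=> h u hu; apply: Qd.
  - by move=> u; rewrite scale1r.
  - by move=> a b ha hb u hu; rewrite scalerDl; apply: QD; [apply: ha | apply: hb].
  - by move=> a b ha hb u hu; rewrite -scalerA; apply: ha; apply: hb.
  - by move=> c a ha u hu; rewrite -mulr_algl -scalerA; apply: QZ; apply: ha.
rewrite -[v]vreprK; elim: (repr v) => //.
- by move=> a m; rewrite -[vpi _]/(vtens a m) vtensE; apply: Qa.
- by move=> u hu; rewrite -vopp_pi; apply: QN.
- by move=> u hu w hw; rewrite vpiD; apply: QD.
Qed.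

Section Lift.
Variables (Z : lmodType D) (f : M -> Z).
Hypothesis fD : forall m m', f (m + m') = f m + f m'.
Hypothesis fZ : forall c m, f (c *: m) = c%:A *: f m.
Hypothesis fg : forall g m, f (actg M g m) = dg g *: f m.
Hypothesis fd : forall h m, f (actd M h m) = dd h *: f m.
Hypothesis fy : forall t m, dy t *: f m = 0.

Let f_act b F : ge0_act b F -> forall m, b *: f m = f (F m).
Proof.
have f0 : f 0 = 0 by apply: (addIr (f 0)); rewrite -fD !add0r.
elim=> {b F}.
- by move=> g m; rewrite fg.
- by move=> h m; rewrite fd.
- by move=> t m; rewrite f0.
- by move=> m; rewrite scale1r.
- by move=> a b F F' _ h _ h' m; rewrite scalerDl h h' fD.
- by move=> a b F F' _ h _ h' m; rewrite -scalerA h' h.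
- by move=> c a F _ h m; rewrite -mulr_algl -scalerA h fZ.
Qed.

Let ev := fix ev (u : vterm M) : Z :=
  match u with
  | Vpure a m => a *: f m
  | V0 => 0
  | Vopp u => - ev u
  | Vadd u v => ev u + ev v
  end.

Let ev_cong u v : vcong u v -> ev u = ev v.
Proof.
elim=> //=; try by move=> *; congruence.
- by move=> *; rewrite addrA.
- by move=> *; rewrite addrC.
- by move=> *; rewrite add0r.
- by move=> *; rewrite addNr.
- by move=> *; rewrite scalerDl.
- by move=> *; rewrite fD scalerDr.
- by move=> a b F m h; rewrite -scalerA (f_act h).
Qed.

Lemma verma_lift :
  exists F : {linear verma M -> Z}, forall a m, F (vtens a m) = a *: f m.
Proof.
pose F (v : verma M) := ev (repr v).
have Fpi u : F (vpi u) = ev u by exact: ev_cong (vrepr_pi u).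
have lin : linear F.
  move=> a u v; rewrite -[u]vreprK -[v]vreprK.
  rewrite -[a *: _]/(vscale _ _) vscale_pi -vpiD !Fpi /=; congr (_ + _).
  elim: (repr u) => //= [b m||w ->|w -> w' ->].
  - by rewrite scalerA.
  - by rewrite scaler0.
  - by rewrite scalerN.
  - by rewrite scalerDr.
by exists (mk_linear lin) => a m; rewrite mk_linearE Fpi.
Qed.
End Lift.
End VermaTheory.

Definition dxw (w : seq transp) : D := \prod_(t <- w) dx t.

Lemma dxw_cons t w : dxw (t :: w) = dx t * dxw w.
Proof. exact: big_cons. Qed.

Lemma dxw_rcons w t : dxw (rcons w t) = dxw w * dx t.
Proof. by rewrite /dxw -cats1 big_cat big_seq1. Qed.

(** * The basis of the Verma module of weight (e,+) *)

Definition btransp (i : nat) : seq transp := map transp_of (bword i).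
Definition mono (i : nat) : D := dxw (btransp i).

Lemma transpJ_of l m : (l < 3)%N -> (m < 3)%N ->
  (lconj (tr3 l) m < 3)%N ->
  transpJ (val (transp_of l)) (transp_of m) = transp_of (lconj (tr3 l) m).
Proof.
move=> hl hm hc; apply: letter_inj.
by rewrite letterJ -tr3_letter !transp_ofK.
Qed.

Lemma transp_of_neq l m : (l < 3)%N -> (m < 3)%N -> l != m ->
  transp_of l != transp_of m.
Proof. by move=> hl hm; rewrite -(inj_eq letter_inj) !transp_ofK. Qed.

Lemma dx_mono l i : (l < 3)%N -> (i < 12)%N ->
  dx (transp_of l) * mono i = \sum_(p <- xcoefs l i) p.1%:~R * mono p.2.
Proof.
move=> hl hi.
pose x l := dx (transp_of l).
have quad m n : (m < 3)%N -> (n < 3)%N -> m != n -> (lconj (tr3 m) n < 3)%N ->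
    x m * x n + x (lconj (tr3 m) n) * x m + x n * x (lconj (tr3 m) n) = 0.
  move=> hm hn mn hc; rewrite /x -transpJ_of //.
  by apply: dx_quad; exact: transp_of_neq.
have nthx m : (m < 3)%N -> nth 0 [:: x 0%N; x 1%N; x 2%N] m = x m.
  by case: m => [|[|[|//]]].
have monoE j : mono j = nc_word (x 0%N) (x 1%N) (x 2%N) (bword j).
  rewrite /mono /dxw /btransp big_map /nc_word big_seq [RHS]big_seq.
  by apply: eq_bigr => m hm; rewrite nthx // (allP (bword_lt3 j)).
rewrite -/(x l) -[x l]nthx // monoE nc_straighten //.
- by apply: eq_bigr => p _; rewrite monoE.
- exact: dx_sqr.
- exact: dx_sqr.
- exact: dx_sqr.
- exact: (quad 0%N 1%N).
- exact: (quad 1%N 0%N).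
Qed.

Definition wspan (n : nat) (a : D) : Prop :=
  exists c : 'I_12 -> k, a = \sum_(i < 12 | size (bword i) == n) c i *: mono i.

Lemma wspanD n a b : wspan n a -> wspan n b -> wspan n (a + b).
Proof.
case=> c -> [c' ->]; exists (fun i => c i + c' i).
by rewrite -big_split; apply: eq_bigr => i _; rewrite scalerDl.
Qed.

Lemma wspanZ n c a : wspan n a -> wspan n (c *: a).
Proof.
case=> d ->; exists (fun i => c * d i).
by rewrite scaler_sumr; apply: eq_bigr => i _; rewrite scalerA.
Qed.

Lemma wspan0 n : wspan n 0.
Proof. by exists (fun=> 0); rewrite big1 // => i _; rewrite scale0r. Qed.

Lemma wspan_sum I (r : seq I) (P : pred I) n (F : I -> D) :
  (forall i, P i -> wspan n (F i)) -> wspan n (\sum_(i <- r | P i) F i).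
Proof. by move=> h; elim/big_ind: _ => //; [exact: wspan0 | exact: wspanD]. Qed.

Lemma wspan_mono (i : 'I_12) : wspan (size (bword i)) (mono i).
Proof.
exists (fun j => (j == i)%:R); rewrite (bigD1 i) //= eqxx scale1r big1 ?addr0 //.
by move=> j /andP[_ /negPf ->]; rewrite scale0r.
Qed.

Lemma wspan_dx t n a : wspan n a -> wspan n.+1 (dx t * a).
Proof.
case=> c ->; rewrite mulr_sumr; apply: wspan_sum => i /eqP <-.
rewrite -scalerAr; apply: wspanZ.
rewrite -[t]letterK dx_mono ?letter_lt3 // big_seq; apply: wspan_sum => p hp.
have /allP/(_ p hp)/andP[p12 /eqP <-] := xcoefs_deg (letter_lt3 t) (ltn_ord i).
rewrite mulrzl -scaler_int.
by apply: wspanZ; exact: (wspan_mono (Ordinal p12)).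
Qed.

Lemma wspan_dxw w : wspan (size w) (dxw w).
Proof.
elim: w => [|t w IH]; last by rewrite dxw_cons; exact: wspan_dx.
have := wspan_mono ord0; rewrite /mono /btransp /=; exact.
Qed.

Lemma dxw_eq0 w : (4 < size w)%N -> dxw w = 0.
Proof.
move=> hw; have [c ->] := wspan_dxw w; rewrite big1 // => i /eqP e.
have : (size (bword i) <= 4)%N.
  by case: i {e} => [[|[|[|[|[|[|[|[|[|[|[|[|//]]]]]]]]]]]] hi].
by rewrite e leqNgt hw.
Qed.

Definition Me := Mod_e_plus k.
Local Notation Ms := (Mod_sigma_minus k).
Definition V : lmodType D := verma Me.
Implicit Types (v : V) (N : submodClosed V).

Definition vac : V := @vtens k Me 1 (1 : k^o).
Definition vb (i : nat) : V := mono i *: vac.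

Lemma vtens_vac a c : @vtens k Me a c = c%:A *: (a *: vac).
Proof.
rewrite vtensE scalerA mulr_algl -[c *: a]mulr_algr -scalerA; congr (_ *: _).
by rewrite -vtens1Z; congr vtens; rewrite -[RHS]/(c * 1) mulr1.
Qed.

Lemma wspan_vac n a : wspan n a ->
  exists c : 'I_12 -> k, a *: vac = \sum_(i < 12 | size (bword i) == n) (c i)%:A *: vb i.
Proof.
case=> c ->; exists c; rewrite scaler_suml; apply: eq_bigr => i _.
by rewrite -[c i *: mono i]mulr_algl -scalerA.
Qed.

Lemma V_span (v : V) : exists c : 'I_12 -> k, v = \sum_i (c i)%:A *: vb i.
Proof.
pose P (v : V) := exists c : 'I_12 -> k, v = \sum_i (c i)%:A *: vb i.
have PD u w : P u -> P w -> P (u + w).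
  move=> [c ->] [d ->]; exists (fun i => c i + d i).
  by rewrite -big_split; apply: eq_bigr => i _; rewrite !scalerDl.
have PZ c u : P u -> P (c%:A *: u).
  move=> [d ->]; exists (fun i => c * d i).
  by rewrite scaler_sumr; apply: eq_bigr => i _; rewrite scalerA mulr_algl scalerA.
have P0 : P 0 by exists (fun=> 0); rewrite big1 // => i _; rewrite !scale0r.
have Pb (i : 'I_12) : P (vb i).
  exists (fun j => (j == i)%:R); rewrite (bigD1 i) //= eqxx !scale1r.
  by rewrite big1 ?addr0 // => j /negPf ->; rewrite !scale0r.
have Psum I (r : seq I) (Q : pred I) (F : I -> V) :
    (forall i, Q i -> P (F i)) -> P (\sum_(i <- r | Q i) F i).
  by move=> h; elim/big_ind: _.
apply: (verma_ind (P := P)) => //.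
- move=> m; rewrite vtens_vac scale1r; apply: PZ.
  by have := Pb ord0; rewrite /vb /mono /dxw /btransp /= big_nil scale1r.
- move=> t u [c ->]; rewrite scaler_sumr; apply: (Psum) => i _.
  rewrite scalerA mulr_algr -[c i *: _]mulr_algl -scalerA; apply: (PZ).
  rewrite scalerA; have [d ->] := wspan_vac (wspan_dx t (wspan_mono i)).
  by apply: Psum => j _; apply: PZ.
Qed.

Lemma rho_dx t : rho (dx t) = kmx (xi (letter t)).
Proof. exact: rho_pi. Qed.
Lemma rho_dy t : rho (dy t) = kmx (yi (letter t)).
Proof. exact: rho_pi. Qed.
Lemma rho_dg g : rho (dg g) = kmx (gi (code g)).
Proof. exact: rho_pi. Qed.
Lemma rho_dd h : rho (dd h) = kmx (di (code h)).
Proof. exact: rho_pi. Qed.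

Definition e_ (i : nat) : 'cV[k]_12 := \col_(j < 12) (val j == i)%:R.

Lemma idelta_e (r c : nat) : (c < 12)%N -> kmx (idelta r c) *m e_ c = e_ r.
Proof.
move=> c12; apply/matrixP => i j; rewrite !mxE (bigD1 (Ordinal c12)) //= big1.
  by rewrite addr0 !mxE ent_mkimx /= !eqxx andbT mulr1 mulrz_nat.
move=> l /negPf nl; rewrite [e_ _ _ _]mxE -[val l == c]/(l == Ordinal c12).
by rewrite nl mulr0.
Qed.

Lemma kmx_e A j r (c : int) : (j < 12)%N -> imul A (idelta j 0) = iscale c (idelta r 0) ->
  kmx A *m e_ j = c%:~R *: e_ r.
Proof.
move=> j12 /(congr1 kmx); rewrite kmxM kmxZ => /(congr1 (mulmx^~ (e_ 0))).
by rewrite -mulmxA -scalemxAl !idelta_e.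
Qed.

Lemma phi_exists : exists F : {linear V -> fkcol},
  forall a m, F (@vtens k Me a m) = a *: (((m : k) *: e_ 0 : 'cV[k]_12) : fkcol).
Proof.
apply: (@verma_lift Me (fkcol) (fun m : k => (m *: e_ 0 : 'cV[k]_12) : fkcol)).
- by move=> m m'; rewrite scalerDl.
- by move=> c m; rewrite -[RHS]/(rho _ *m _) rhoZ rho1 -scalemxAl mul1mx scalerA.
- move=> g m; rewrite -[RHS]/(rho _ *m _) rho_dg -scalemxAr.
  by rewrite (kmx_e _ (gi_vacuum (mem_code g))) // scale1r.
- move=> h m; rewrite -[RHS]/(rho _ *m _) rho_dd -scalemxAr.
  rewrite (kmx_e _ (di_vacuum (mem_code h))) // -code1 (inj_eq code_inj) /= /ep_actd.
  by case: eqP; rewrite ?scale1r ?scale0r ?scaler0.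
- move=> t m; rewrite -[LHS]/(rho _ *m _) rho_dy -scalemxAr.
  by rewrite (kmx_e _ (yi_vacuum (letter_lt3 t))) // scale0r scaler0.
Qed.

Definition phi : {linear V -> fkcol} := projT1 (cid phi_exists).

Lemma phi_scale a (v : V) : phi (a *: v) = rho a *m phi v.
Proof. exact: linearZ. Qed.

Lemma phi_vac : phi vac = e_ 0.
Proof. by rewrite /phi; case: cid => F hF /=; rewrite hF scale1r scale1r. Qed.

Lemma rho_dxw w : all (fun l => (l < 3)%N) w -> rho (dxw (map transp_of w)) = kmx (ixw w).
Proof.
elim: w => [|l w IH] /=; first by rewrite /dxw big_nil rho1 kmx1.
by case/andP=> hl hw; rewrite dxw_cons rhoM IH // rho_dx transp_ofK // kmxM.
Qed.

Lemma phi_vb i : (i < 12)%N -> phi (vb i) = e_ i.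
Proof.
move=> hi; rewrite phi_scale phi_vac rho_dxw; last exact: bword_lt3.
by rewrite (kmx_e _ (ixw_vacuum hi)) // scale1r.
Qed.

Definition vcoord (v : V) (i : nat) : k := phi v (inord i) 0.

Lemma vcoordD u v i : vcoord (u + v) i = vcoord u i + vcoord v i.
Proof. by rewrite /vcoord linearD mxE. Qed.

Lemma vcoordN u i : vcoord (- u) i = - vcoord u i.
Proof. by rewrite /vcoord linearN mxE. Qed.

Lemma vcoordZ c v i : vcoord (c%:A *: v) i = c * vcoord v i.
Proof. by rewrite /vcoord phi_scale rhoZ rho1 -scalemxAl mul1mx mxE. Qed.

Lemma vcoord0 i : vcoord 0 i = 0.
Proof. by rewrite /vcoord linear0 mxE. Qed.

Lemma vcoord_sum I (r : seq I) (P : pred I) (F : I -> V) i :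
  vcoord (\sum_(j <- r | P j) F j) i = \sum_(j <- r | P j) vcoord (F j) i.
Proof. by rewrite /vcoord linear_sum summxE. Qed.

Lemma vcoord_vb i j : (i < 12)%N -> (j < 12)%N -> vcoord (vb i) j = (j == i)%:R.
Proof. by move=> hi hj; rewrite /vcoord phi_vb // mxE /= inordK. Qed.

Lemma vcoordE (v : V) : v = \sum_(i < 12) (vcoord v i)%:A *: vb i.
Proof.
have [c hc] := V_span v; rewrite {1}hc; apply: eq_bigr => i _; congr (_%:A *: _).
rewrite hc vcoord_sum (bigD1 i) //= vcoordZ vcoord_vb // eqxx mulr1 big1 ?addr0 //.
by move=> j /negPf nj; rewrite vcoordZ vcoord_vb // -[val i == j]/(i == j) eq_sym nj mulr0.
Qed.

Lemma vcoord_inj u v : (forall i, (i < 12)%N -> vcoord u i = vcoord v i) -> u = v.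
Proof.
by move=> h; rewrite [u]vcoordE [v]vcoordE; apply: eq_bigr => i _; rewrite h.
Qed.

Lemma phi_inj : injective phi.
Proof. by move=> u v h; apply: vcoord_inj => i _; rewrite /vcoord h. Qed.

Lemma idelta_phi (r i : nat) v : (i < 12)%N ->
  kmx (idelta r i) *m phi v = vcoord v i *: e_ r.
Proof.
move=> hi; apply/matrixP => j j'; rewrite !mxE (bigD1 (inord i)) //= big1 ?addr0.
  rewrite !mxE ent_mkimx inordK // eqxx andbT mulrz_nat mulrC; congr (_ * _).
  by rewrite /vcoord (ord1 j').
move=> l /negPf nl; rewrite !mxE ent_mkimx.
suff -> : (val l == i) = false by rewrite andbF mul0r.
by rewrite -nl -val_eqE /= inordK.
Qed.

Lemma scale_unit a r i (c : int) v : (r < 12)%N -> (i < 12)%N ->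
  rho a = kmx (iscale c (idelta r i)) -> a *: v = (c%:~R * vcoord v i)%:A *: vb r.
Proof.
move=> hr hi ha.
apply: phi_inj; rewrite phi_scale [RHS]phi_scale ha phi_vb // kmxZ rhoZ rho1.
by rewrite -!scalemxAl mul1mx idelta_phi // scalerA.
Qed.

(** * Submodules *)

Lemma scale_algC (W : lmodType D) (a : D) c (w : W) :
  a *: (c%:A *: w) = c%:A *: (a *: w).
Proof. by rewrite !scalerA mulr_algl mulr_algr. Qed.

Lemma scale_algA (W : lmodType D) c (d : k) (w : W) :
  c%:A *: ((d%:A : D) *: w) = (c * d)%:A *: w.
Proof. by rewrite scalerA mulr_algl scalerA. Qed.

Definition opw (w : seq (bool * nat)) : D :=
  \prod_(p <- w) (if p.1 then dx else dy) (transp_of p.2).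

Lemma rho_opw w : good_word w -> rho (opw w) = kmx (iop w).
Proof.
elim: w => [|[b l] w IH] /=; first by rewrite /opw big_nil rho1 kmx1.
case/andP=> /= hl hw; rewrite /opw big_cons -/(opw w) rhoM IH // kmxM.
by case: b; rewrite ?rho_dx ?rho_dy transp_ofK.
Qed.

Definition tdeg (w : seq transp) : 'S_3 := foldr (fun t d => val t ∘∘ d) 1%g w.

Lemma code_tdeg i : code (tdeg (btransp i)) = wdeg (bword i).
Proof.
rewrite /btransp; have := bword_lt3 i; elim: (bword i) => [|l w IH] /=; first by rewrite code1.
by case/andP=> hl hw; rewrite code_comp -tr3_letter transp_ofK // IH.
Qed.

Lemma is_pmP A r i : is_pm A r i ->
  exists2 c : int, c%:~R != 0 :> k & A = iscale c (idelta r i).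
Proof.
case/orP=> /eqP ->; first by exists 1; rewrite ?oner_eq0.
by exists (-1); rewrite // mulrN1z oppr_eq0 oner_eq0.
Qed.

Lemma mem_unscale N c v : c != 0 -> c%:A *: v \in N -> v \in N.
Proof.
move=> c0 /(rpredZ (c^-1%:A : D)).
by rewrite scalerA mulr_algl scalerA mulVf // !scale1r.
Qed.

Lemma mem_unit N a A r i v : (r < 12)%N -> (i < 12)%N ->
  rho a = kmx A -> is_pm A r i -> v \in N -> vcoord v i != 0 -> vb r \in N.
Proof.
move=> hr hi ha /is_pmP[c c0 hA] vN v0.
apply: (@mem_unscale N (c%:~R * vcoord v i)); first by rewrite mulf_neq0.
by rewrite -(@scale_unit a r i c v) // ?rpredZ // -hA.
Qed.

Lemma vcoord_neq0 v : v != 0 -> exists2 i, (i < 12)%N & vcoord v i != 0.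
Proof.
move=> v0; apply: contrapT => h; case/eqP: v0; apply: vcoord_inj => i hi.
rewrite vcoord0; apply/eqP; apply: contrapT => /negP hn; apply: h; by exists i.
Qed.

Lemma mem_top N v : v \in N -> v != 0 -> vb 11 \in N.
Proof.
move=> vN /vcoord_neq0 [j j12 vj].
have [[i i11 vi]|hn] := EM (exists2 i, (i < 11)%N & vcoord v i != 0).
  have /andP[hw hpm] := to_topP i11; have i12 : (i < 12)%N := ltnW i11.
  apply: (mem_unit (a := opw (nth [::] to_top i) * dd (tdeg (btransp i))) _ i12 _ hpm vN vi) => //.
  by rewrite rhoM rho_opw // rho_dd code_tdeg kmxM.
have v0 i : (i < 11)%N -> vcoord v i = 0.
  move=> hi; apply/eqP; apply: contrapT => /negP h; apply: hn; by exists i.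
have ej : j = 11%N.
  by apply/eqP; rewrite eqn_leq -ltnS j12 leqNgt; apply/negP => /v0 h; rewrite h eqxx in vj.
apply: (@mem_unscale N (vcoord v 11)); first by rewrite -ej.
suff <- : v = (vcoord v 11)%:A *: vb 11 by [].
rewrite {1}[v]vcoordE big_ord_recr big1 /= ?add0r // => i _.
by rewrite v0 //= !scale0r.
Qed.

Lemma mem_x N v i : v \in N -> (i < 10)%N -> vcoord v i.+1 != 0 -> vb 1 \in N.
Proof.
move=> vN i10 vi; have /andP[hw hpm] := to_xP i10.
apply: (mem_unit (a := opw (nth [::] to_x i) * dd (tdeg (btransp i.+1))) _ _ _ hpm vN vi) => //.
  by rewrite ltnS (ltn_trans i10).
by rewrite rhoM rho_opw // rho_dd code_tdeg kmxM.
Qed.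

Lemma mem_positive N v : vb 1 \in N -> vcoord v 0 = 0 -> v \in N.
Proof.
move=> N1 v0.
have Nb i : (i < 11)%N -> vb i.+1 \in N.
  move=> hi; have /andP[hw /is_pmP[c c0 hc]] := from_xP hi.
  apply: (@mem_unscale N c%:~R) => //.
  suff <- : opw (nth [::] from_x i) *: vb 1 = c%:~R%:A *: vb i.+1 by rewrite rpredZ.
  apply: phi_inj; rewrite phi_scale [RHS]phi_scale !phi_vb // rho_opw //.
  rewrite (kmx_e _ hc) //.
  by rewrite rhoZ rho1 -scalemxAl mul1mx.
rewrite [v]vcoordE big_ord_recl /= v0 !scale0r add0r rpred_sum // => i _.
by rewrite rpredZ // Nb.
Qed.

Lemma mem_full N v : v \in N -> vcoord v 0 != 0 -> full_submod N.
Proof.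
move=> vN v0.
have vn0 : v != 0 by apply/eqP => e; rewrite e vcoord0 eqxx in v0.
have Ntop := mem_top vN vn0.
have N0 : vac \in N.
  apply: (@mem_unscale N (vcoord v 0)) => //.
  have -> : (vcoord v 0)%:A *: vac = dd 1%g *: v - (vcoord v 11)%:A *: vb 11.
    apply: phi_inj; rewrite linearB phi_scale [phi (dd _ *: v)]phi_scale
      [phi (_ *: vb 11)]phi_scale phi_vb // phi_vac rho_dd code1 di1 kmxD.
    by rewrite mulmxDl !idelta_phi // !rhoZ rho1 -!scalemxAl !mul1mx addrK.
  by rewrite -scaleNr; apply: rpredD; apply: rpredZ.
by move=> w; rewrite [w]vcoordE rpred_sum // => i _; rewrite rpredZ // rpredZ.
Qed.

Definition Vpos : submodClosed V := submod_generated (fun v => vcoord v 0 = 0).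
Definition Vtop : submodClosed V :=
  submod_generated (fun v => exists c, v = c%:A *: vb 11).

Lemma extreme_kmx A (c : int) : extreme_check A c ->
  kmx (idelta 0 0) *m kmx A = c%:~R *: kmx (idelta 0 0) /\
  kmx A *m kmx (idelta 11 11) = c%:~R *: kmx (idelta 11 11).
Proof. by case/andP=> /eqP h /eqP h'; rewrite -!kmxM h h' !kmxZ. Qed.

Lemma extreme_character (a : D) : exists c,
  kmx (idelta 0 0) *m rho a = c *: kmx (idelta 0 0) /\
  rho a *m kmx (idelta 11 11) = c *: kmx (idelta 11 11).
Proof.
elim/fk_ind: a.
- move=> t; have /andP[h _] := extreme_xy (letter_lt3 t).
  by exists 0%:~R; rewrite rho_dx; exact: extreme_kmx.
- move=> t; have /andP[_ h] := extreme_xy (letter_lt3 t).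
  by exists 0%:~R; rewrite rho_dy; exact: extreme_kmx.
- move=> g; have /andP[h _] := extreme_gd (mem_code g).
  by exists 1%:~R; rewrite rho_dg; exact: extreme_kmx.
- move=> h; have /andP[_ hh] := extreme_gd (mem_code h).
  by exists (code h == id3)%:R%:~R; rewrite rho_dd; exact: extreme_kmx.
- by exists 1; rewrite rho1 mulmx1 mul1mx !scale1r.
- move=> a b [c [ha ha']] [d [hb hb']]; exists (c + d).
  by rewrite rhoD mulmxDl mulmxDr ha ha' hb hb' !scalerDl.
- move=> a b [c [ha ha']] [d [hb hb']]; exists (c * d).
  rewrite rhoM mulmxA ha -scalemxAl hb scalerA; split=> //.
  by rewrite -mulmxA hb' -scalemxAr ha' scalerA mulrC.
- move=> c a [d [ha ha']]; exists (c * d).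
  by rewrite rhoZ -scalemxAr -scalemxAl ha ha' !scalerA.
Qed.

Lemma characterP (a : D) : exists c,
  (forall v, vcoord (a *: v) 0 = c * vcoord v 0) /\ a *: vb 11 = c%:A *: vb 11.
Proof.
have [c [h0 h11]] := extreme_character a; exists c; split=> [v|].
  have e w : vcoord w 0 = (kmx (idelta 0 0) *m phi w) 0 0.
    by rewrite idelta_phi // !mxE /= mulr1.
  by rewrite e phi_scale mulmxA h0 -scalemxAl mxE -e.
apply: phi_inj; rewrite phi_scale [RHS]phi_scale phi_vb // rhoZ rho1.
rewrite -scalemxAl mul1mx -[in LHS](idelta_e 11 (isT : 11 < 12)%N) mulmxA h11.
by rewrite -scalemxAl idelta_e.
Qed.

Lemma VposP v : v \in Vpos <-> vcoord v 0 = 0.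
Proof.
apply: (generatedE (A := fun v => vcoord v 0 = 0)); first exact: vcoord0.
- by move=> u w hu hw; rewrite vcoordD hu hw addr0.
- by move=> a w hw; have [c [-> _]] := characterP a; rewrite hw mulr0.
Qed.

Lemma VtopP v : v \in Vtop <-> exists c, v = c%:A *: vb 11.
Proof.
apply: (generatedE (A := fun v => exists c, v = c%:A *: vb 11)).
- by exists 0; rewrite !scale0r.
- by move=> _ _ [c ->] [d ->]; exists (c + d); rewrite !scalerDl.
- move=> a _ [c ->]; have [d [_ h]] := characterP a; exists (c * d).
  by rewrite scale_algC h scale_algA.
Qed.

Lemma Vtop_coord v : v \in Vtop <-> forall i, (i < 11)%N -> vcoord v i = 0.
Proof.
split=> [/VtopP[c ->] i hi|h].
  have i12 : (i < 12)%N := ltnW hi.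
  by rewrite vcoordZ vcoord_vb // (ltn_eqF hi) mulr0.
apply/VtopP; exists (vcoord v 11); rewrite {1}[v]vcoordE big_ord_recr big1 /= ?add0r // => i _.
by rewrite h //= !scale0r.
Qed.

Lemma Vtop_sub_Vpos : {subset Vtop <= Vpos}.
Proof. by move=> v /Vtop_coord h; apply/VposP/h. Qed.

Lemma vb_Vpos i : (0 < i < 12)%N -> vb i \in Vpos.
Proof. by case/andP=> i0 i12; apply/VposP; rewrite vcoord_vb // eq_sym (gtn_eqF i0). Qed.

Lemma vb1_notin_Vtop : vb 1 \notin Vtop.
Proof.
apply/negP => /Vtop_coord/(_ 1%N isT)/eqP.
by rewrite vcoord_vb // eqxx oner_eq0.
Qed.

Lemma vb11_neq0 : vb 11 != 0.
Proof.
apply/eqP => /(congr1 (fun v => vcoord v 11))/eqP.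
by rewrite vcoord_vb // vcoord0 eqxx oner_eq0.
Qed.

Lemma Vpos_notfull : ~ full_submod Vpos.
Proof.
move=> /(_ vac)/VposP/eqP.
by rewrite /vcoord phi_vac mxE /= inordK //= oner_eq0.
Qed.

Lemma submod_notin_Vpos N v : v \in N -> v \notin Vpos -> full_submod N.
Proof. by move=> vN vX; apply: (mem_full vN); apply: contra vX => /eqP /VposP. Qed.

Lemma submod_notin_Vtop N v : v \in N -> v \notin Vtop -> {subset Vpos <= N}.
Proof.
move=> vN vS w Xw; have [/VposP Xv|nXv] := boolP (v \in Vpos); last first.
  exact: (submod_notin_Vpos vN nXv).
apply: mem_positive; last exact/VposP.
apply: contrapT => nN1; case/negP: vS; apply/Vtop_coord => -[//|i] hi.
apply/eqP; apply: contrapT => /negP vi; apply: nN1.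
exact: (mem_x vN hi vi).
Qed.

Lemma submod_neq0 N v : v \in N -> v != 0 -> {subset Vtop <= N}.
Proof. by move=> vN v0 _ /VtopP[c ->]; rewrite rpredZ // (mem_top vN v0). Qed.

Lemma Vpos_maximal : unique_maximal_submod (mod_radical V) /\ mod_radical V =i Vpos.
Proof.
apply: unique_maximalP; first exact: Vpos_notfull.
move=> N; have [[v vN vX]|h] := EM (exists2 v, v \in N & v \notin Vpos).
  by right; apply: submod_notin_Vpos vN vX.
by left=> v vN; apply: contrapT => /negP nX; apply: h; exists v.
Qed.

Lemma submod_val_neq0 N (u : submod N) : (submod_val u != 0) = (u != 0).
Proof. by rewrite -(inj_eq val_inj). Qed.

Lemma Vtop_simple : simple_module (submod Vtop).
Proof.
have S11 : vb 11 \in Vtop by apply/VtopP; exists 1; rewrite !scale1r.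
split; first by exists (Submod S11); rewrite -submod_val_neq0 vb11_neq0.
move=> N; have [|[u uN u0]] := zeroP N; [by left | right=> w].
have /VtopP[c uE] := submod_valP u; have /VtopP[d wE] := submod_valP w.
have c0 : c != 0.
  apply: contraNneq u0 => c0; apply/eqP/val_inj => /=.
  by rewrite uE c0 !scale0r.
suff -> : w = (d / c)%:A *: u by rewrite rpredZ.
apply: val_inj; rewrite /= wE.
rewrite -[RHS]/((d / c)%:A *: submod_val u) uE scalerA mulr_algl scalerA divfK //.
Qed.

Lemma mod_socleE : mod_socle V =i Vtop.
Proof.
move=> v; apply/idP/idP => [|vS]; last first.
  by apply: mem_generated; exists Vtop => //; exact: Vtop_simple.
apply: generated_min => {}v [N [[n n0] simN] vN].
have SN : {subset Vtop <= N}.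
  by apply: (submod_neq0 (submod_valP n)); rewrite submod_val_neq0.
have Ntop : vb 11 \in N by apply/SN/VtopP; exists 1; rewrite !scale1r.
case: (simN (@trace_pred _ V N Vtop)) => [h|/(_ (Submod vN)) //].
have /(congr1 (@submod_val _ _ N)) /= e : Submod Ntop = 0.
  by apply: h; rewrite unfold_in /trace_pred /=; apply/VtopP; exists 1; rewrite !scale1r.
by case/eqP: vb11_neq0.
Qed.

Lemma submod_classification N :
  ~ zero_submod N /\ ~ full_submod N <-> N =i mod_socle V \/ N =i mod_radical V.
Proof.
have [_ radE] := Vpos_maximal.
split=> [[nz nf]|].
  have [//|[v vN v0]] := zeroP N.
  have SN := submod_neq0 vN v0.
  have NX : {subset N <= Vpos}.
    move=> w wN; apply: contrapT => /negP wX; exact/nf/(submod_notin_Vpos wN wX).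
  have [[w wN wS]|h] := EM (exists2 w, w \in N & w \notin Vtop).
    right=> u; rewrite radE; apply/idP/idP; first exact: NX.
    exact: submod_notin_Vtop wN wS u.
  left=> u; rewrite mod_socleE; apply/idP/idP; last exact: SN.
  by move=> uN; apply: contrapT => /negP uS; apply: h; exists u.
have S11 : vb 11 \in Vtop by apply/VtopP; exists 1; rewrite !scale1r.
have hz : vb 11 \in N -> ~ zero_submod N.
  by move=> h /(_ _ h) e; case/eqP: vb11_neq0.
have hf : {subset N <= Vpos} -> ~ full_submod N.
  by move=> h f; apply: Vpos_notfull => w; apply/h/f.
case=> e; split.
- by apply: hz; rewrite e mod_socleE.
- by apply: hf => w; rewrite e mod_socleE; exact: Vtop_sub_Vpos.
- by apply: hz; rewrite e radE; exact: Vtop_sub_Vpos.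
- by apply: hf => w; rewrite e radE.
Qed.

(** * Degrees and weights *)

Lemma vcoord_wspan n a i : wspan n a -> (i < 12)%N -> size (bword i) != n ->
  vcoord (a *: vac) i = 0.
Proof.
move=> /wspan_vac[c ->] hi ni; rewrite vcoord_sum big1 // => j /eqP hj.
rewrite vcoordZ vcoord_vb //; case: eqP => [e|]; last by rewrite mulr0.
by rewrite e hj eqxx in ni.
Qed.

Lemma vdeg0 n : @vdeg k Me n 0.
Proof.
by exists (fun=> 0); rewrite big1 // => w _; rewrite vtens_vac !scale0r.
Qed.

Lemma vdegD n u v : @vdeg k Me n u -> @vdeg k Me n v -> @vdeg k Me n (u + v).
Proof.
case=> f -> [f' ->]; exists (fun w => f w + f' w).
by rewrite -big_split; apply: eq_bigr => w _; rewrite vtensDr.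
Qed.

Lemma vdegZ n c v : @vdeg k Me n v -> @vdeg k Me n (c%:A *: v).
Proof.
case=> f ->; exists (fun w => (c * f w : k)).
by rewrite scaler_sumr; apply: eq_bigr => w _; rewrite !vtens_vac scale_algA.
Qed.

Lemma vdeg_dxw w : @vdeg k Me (size w) (dxw w *: vac).
Proof.
exists (fun w' => (w' == in_tuple w)%:R : k); rewrite (bigD1 (in_tuple w)) //= [X in _ + X]big1.
  by rewrite eqxx vtens_vac !scale1r addr0.
by move=> w' /negPf ->; rewrite vtens_vac !scale0r.
Qed.

Definition homog n v : V :=
  \sum_(i < 12 | size (bword i) == n) (vcoord v i)%:A *: vb i.

Lemma vdeg_homog n v : @vdeg k Me n (homog n v).
Proof.
rewrite /homog; elim/big_ind: _ => [||i /eqP <-]; first exact: vdeg0.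
  exact: vdegD.
by apply: vdegZ; have := vdeg_dxw (btransp i); rewrite size_map.
Qed.

Lemma vcoord_homog n v i : (i < 12)%N ->
  vcoord (homog n v) i = if size (bword i) == n then vcoord v i else 0.
Proof.
move=> hi; rewrite /homog vcoord_sum.
under eq_bigr => j _ do rewrite vcoordZ vcoord_vb //.
rewrite big_mkcond /= (bigD1 (Ordinal hi)) //= eqxx mulr1 big1 ?addr0 // => j nj.
by rewrite -val_eqE /= eq_sym in nj; rewrite (negPf nj) mulr0 if_same.
Qed.

Lemma vdegP n v : @vdeg k Me n v <->
  forall i, (i < 12)%N -> size (bword i) != n -> vcoord v i = 0.
Proof.
split=> [[f ->] i hi ni|h].
  rewrite vcoord_sum big1 // => w _; rewrite vtens_vac vcoordZ.
  rewrite (@vcoord_wspan n) ?mulr0 //.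
  by have := wspan_dxw w; rewrite size_tuple.
suff -> : v = homog n v by exact: vdeg_homog.
by apply: vcoord_inj => i hi; rewrite vcoord_homog //; case: ifP => // /negbT /h ->.
Qed.

Lemma Vpos_direct_sum : internal_direct_sum (fun i : 'I_4 => @vdeg k Me i.+1) (mod_radical V).
Proof.
have [_ radE] := Vpos_maximal.
split=> [v|u hu u0 i]; last first.
  apply: vcoord_inj => j hj; rewrite vcoord0.
  have [e|ne] := eqVneq (size (bword j)) i.+1; last by have /vdegP := hu i; apply.
  have := congr1 (fun v => vcoord v j) u0; rewrite vcoord_sum vcoord0 (bigD1 i) //=.
  rewrite big1 ?addr0 // => i' ni'; have /vdegP := hu i'; apply=> //.
  by rewrite e eqSS eq_sym.
rewrite radE; split=> [/VposP v0|[u hu ->]]; last first.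
  apply/VposP; rewrite vcoord_sum big1 // => i _; have /vdegP := hu i; exact.
exists (fun i : 'I_4 => homog i.+1 v) => [i|]; first exact: vdeg_homog.
apply: vcoord_inj => j hj; rewrite vcoord_sum.
have [->|j0] := posnP j; first by rewrite big1 // => i _; rewrite vcoord_homog.
have hj' : (0 < j < 12)%N by rewrite j0.
have /andP[s0 s4] := bword_size hj'.
have si : ((size (bword j)).-1 < 4)%N by rewrite prednK.
rewrite (bigD1 (Ordinal si)) //= vcoord_homog // prednK // eqxx big1 ?addr0 //.
move=> i ni; rewrite vcoord_homog //; case: eqP => // e; case/eqP: ni.
by apply: val_inj; rewrite /= e.
Qed.

Lemma Vtop_degree v : v \in mod_socle V <-> @vdeg k Me 4 v.
Proof.
rewrite mod_socleE Vtop_coord vdegP; split=> h i hi.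
  move=> ni; apply: h; move: ni hi; rewrite ltnS leq_eqVlt => ni /orP[/eqP e|//].
  by rewrite e in ni.
apply: h; first exact: ltnW.
by case: i hi => [|[|[|[|[|[|[|[|[|[|[|//]]]]]]]]]]].
Qed.

Lemma dg_vac g : dg g *: vac = vac.
Proof. exact: act_vtens1 (ge0_g Me g). Qed.

Lemma dd_vac h : dd h *: vac = if h == 1%g then vac else 0.
Proof.
rewrite (act_vtens1 _ (ge0_d Me h)) /= /ep_actd; case: eqP => // _.
exact: vtens10.
Qed.

Lemma dy_vac t : dy t *: vac = 0.
Proof. by rewrite (act_vtens1 _ (ge0_y Me t)) /= vtens10. Qed.

Lemma dg_dx_vac g t : dg g *: (dx t *: vac) = (sgn k g)%:A *: (dx (transpJ g t) *: vac).
Proof. by rewrite scalerA dg_dx -[_ *: (_ * _)]mulr_algl -!scalerA dg_vac. Qed.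

Lemma dd_dx_vac h t : dd h *: (dx t *: vac) = if val t == h then dx t *: vac else 0.
Proof.
rewrite scalerA dd_dx -scalerA dd_vac -[val t]transpV -eq_mulgV1 transpV eq_sym.
by case: eqP; rewrite ?scaler0.
Qed.

Lemma dy_dx_vac s t : dy s *: (dx t *: vac) = 0.
Proof.
rewrite scalerA dy_dx scalerBl scalerDl -!scalerA dy_vac scaler0 subr0 scalerBl !dd_vac.
rewrite transp_neq1 transp_mul_eq1 sub0r scalerN.
by case: eqP; rewrite ?scale1r ?scale0r ?scaler0 ?dg_vac ?subrr ?subr0.
Qed.

Lemma dx_vac t : dx t *: vac = vb (letter t).+1.
Proof.
rewrite /vb; congr (_ *: _); rewrite -{1}[t]letterK /mono /btransp.
by case: (letter t) (letter_lt3 t) => [|[|[|//]]] _; rewrite /dxw /= big_seq1.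
Qed.

Definition deg1 (m : Ms) : V := \sum_t ((m t : k)%:A : D) *: (dx t *: vac).

Lemma deg1D m m' : deg1 (m + m') = deg1 m + deg1 m'.
Proof. by rewrite -big_split; apply: eq_bigr => t _; rewrite ffunE !scalerDl. Qed.

Lemma deg1Z c m : deg1 (c *: m) = c%:A *: deg1 m.
Proof. by rewrite scaler_sumr; apply: eq_bigr => t _; rewrite ffunE scale_algA. Qed.

Lemma deg1_g g m : deg1 (actg Ms g m) = dg g *: deg1 m.
Proof.
rewrite scaler_sumr [LHS](reindex_inj (can_inj (transpJK g))); apply: eq_bigr => t _.
by rewrite ffunE transpJK scale_algC dg_dx_vac scale_algA mulrC.
Qed.

Lemma deg1_d h m : deg1 (actd Ms h m) = dd h *: deg1 m.
Proof.
rewrite scaler_sumr; apply: eq_bigr => t _.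
by rewrite ffunE scale_algC dd_dx_vac; case: eqP => _; rewrite // !scale0r scaler0.
Qed.

Lemma deg1_y t m : dy t *: deg1 m = 0.
Proof. by rewrite scaler_sumr big1 // => s _; rewrite scale_algC dy_dx_vac scaler0. Qed.

Lemma vcoord_deg1 m t : vcoord (deg1 m) (letter t).+1 = m t.
Proof.
have l12 s : ((letter s).+1 < 12)%N by rewrite ltnS (ltn_trans (letter_lt3 s)).
rewrite vcoord_sum (bigD1 t) //= big1 => [|s st].
  by rewrite vcoordZ dx_vac vcoord_vb // eqxx mulr1 addr0.
by rewrite vcoordZ dx_vac vcoord_vb // eqSS (inj_eq letter_inj) eq_sym (negPf st) mulr0.
Qed.

Lemma deg1_inj : injective deg1.
Proof. by move=> m m' e; apply/ffunP => t; rewrite -!vcoord_deg1 e. Qed.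

Lemma deg1_Vpos m : deg1 m \in Vpos.
Proof.
rewrite rpred_sum // => t _; rewrite rpredZ // dx_vac vb_Vpos //=.
by rewrite ltnS (ltn_trans (letter_lt3 t)).
Qed.

Lemma highest_weight_Vpos : highest_weight Ms (mod_radical V).
Proof.
have [_ radE] := Vpos_maximal.
exists (fun v => exists m, v = deg1 m); split.
- exists deg1; split=> //.
  + by split=> //; exact: deg1_inj.
  + exact: deg1D.
  + exact: deg1Z.
  + exact: deg1_g.
  + exact: deg1_d.
- by move=> t _ [m ->]; exact: deg1_y.
- move=> v; rewrite radE; apply/idP/idP; last first.
    by apply: generated_min => _ [m ->]; exact: deg1_Vpos.
  suff N1 : vb 1 \in submod_generated (fun v => exists m, v = deg1 m).
    exact: submod_notin_Vtop N1 vb1_notin_Vtop v.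
  apply: mem_generated.
  exists [ffun t => (letter t == 0%N)%:R]; rewrite /deg1 (bigD1 (transp_of 0)) //=.
  rewrite ffunE dx_vac transp_ofK // eqxx !scale1r big1 ?addr0 // => t.
  rewrite ffunE -(inj_eq letter_inj) transp_ofK // => /negPf ->.
  by rewrite !scale0r.
Qed.

Lemma top_extreme a A (c : int) : rho a = kmx A -> extreme_check A c ->
  a *: vb 11 = c%:~R%:A *: vb 11.
Proof.
move=> ha hA; have [_ h] := extreme_kmx hA; apply: phi_inj.
rewrite phi_scale [RHS]phi_scale phi_vb // rhoZ rho1 -scalemxAl mul1mx ha.
by rewrite -[in LHS](idelta_e 11 (isT : 11 < 12)%N) mulmxA h -scalemxAl idelta_e.
Qed.

Lemma dg_top g : dg g *: vb 11 = vb 11.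
Proof.
have /andP[h _] := extreme_gd (mem_code g).
by rewrite (top_extreme (rho_dg g) h) !scale1r.
Qed.

Lemma dd_top h : dd h *: vb 11 = if h == 1%g then vb 11 else 0.
Proof.
have /andP[_ hh] := extreme_gd (mem_code h).
rewrite (top_extreme (rho_dd h) hh) -code1 (inj_eq code_inj).
by case: eqP; rewrite ?scale1r ?scale0r.
Qed.

Lemma dy_top t : dy t *: vb 11 = 0.
Proof.
have /andP[_ h] := extreme_xy (letter_lt3 t).
by rewrite (top_extreme (rho_dy t) h) !scale0r.
Qed.

Lemma highest_weight_Vtop : highest_weight Me (mod_socle V).
Proof.
exists (fun v => exists c, v = c%:A *: vb 11); split.
- exists (fun m : k => m%:A *: vb 11); split.
  + split=> // m m' /(congr1 (fun v => vcoord v 11)).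
    by rewrite !vcoordZ vcoord_vb // eqxx !mulr1.
  + by move=> m m'; rewrite !scalerDl.
  + by move=> c m; rewrite scale_algA.
  + by move=> g m; rewrite scale_algC dg_top.
  + move=> h m; rewrite scale_algC dd_top /= /ep_actd.
    by case: eqP; rewrite ?scale0r ?scaler0.
- by move=> t _ [c ->]; rewrite scale_algC dy_top scaler0.
- exact: mod_socleE.
Qed.

Section Augmentation.
Variable M : ds3mod k.

(* [aug n] is J^n (verma M), with J the augmentation ideal of the Nichols
   algebra; J^5 = 0. *)
Inductive aug (n : nat) : verma M -> Prop :=
| aug0 : aug n 0
| augD (u v : verma M) of aug n u & aug n v : aug n (u + v)
| augW w m of (n <= size w)%N : aug n (dxw w *: vtens 1 m).

Lemma aug_dxw n w u : aug n u -> aug (size w + n) (dxw w *: u).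
Proof.
elim=> [|u1 u2 _ h1 _ h2|w' m hw].
- by rewrite scaler0; exact: aug0.
- by rewrite scalerDr; exact: augD.
- rewrite scalerA /dxw -big_cat; apply: augW.
  by rewrite size_cat leq_add2l.
Qed.

Lemma aug_le p n u : (p <= n)%N -> aug n u -> aug p u.
Proof.
move=> pn; elim=> [|u1 u2 _ h1 _ h2|w m hw]; [exact: aug0 | exact: augD |].
by apply: augW; exact: leq_trans hw.
Qed.

Lemma aug_vanish u : aug 5 u -> u = 0.
Proof.
elim=> // [u1 u2 _ -> _ ->|w m hw]; first by rewrite addr0.
by rewrite dxw_eq0 // scale0r.
Qed.

Lemma verma_aug (v : verma M) : exists m j, aug 1 j /\ v = vtens 1 m + j.
Proof.
move: v; apply: verma_ind.
- by move=> m; exists m, 0; split; [exact: aug0 | rewrite addr0].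
- move=> _ _ [m [j [hj ->]]] [m' [j' [hj' ->]]].
  by exists (m + m'), (j + j'); split; [exact: augD | rewrite vtensDr addrACA].
- move=> t _ [m [j [hj ->]]]; exists 0, (dx t *: (vtens 1 m + j)).
  rewrite vtens10 add0r; split=> //; rewrite scalerDr.
  have e u : dx t *: u = dxw [:: t] *: u by rewrite /dxw big_seq1.
  by apply: augD; rewrite e; [exact: augW | apply: aug_le (aug_dxw [:: t] hj)].
Qed.

Lemma verma_nakayama (N : submodClosed (verma M)) :
  (forall m, exists2 n, n \in N & aug 1 (n - vtens 1 m)) -> full_submod N.
Proof.
move=> hN.
have step n u : aug n u -> exists2 x, x \in N & aug n.+1 (u + x).
  elim=> [|u1 u2 _ [x1 N1 h1] _ [x2 N2 h2]|w m hw].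
  - by exists 0; rewrite ?rpred0 ?addr0 //; exact: aug0.
  - by exists (x1 + x2); rewrite ?rpredD // addrACA; exact: augD.
  - have [x xN hx] := hN (- m); exists (dxw w *: x); first exact: rpredZ.
    have vN : vtens 1 (- m) = - vtens 1 m.
      by apply/eqP; rewrite -addr_eq0 -vtensDr addNr vtens10.
    rewrite -scalerDr; move: hx; rewrite vN opprK addrC => hx.
    by apply: aug_le (aug_dxw w hx); rewrite addn1.
have desc d u : (d <= 5)%N -> aug (5 - d) u -> u \in N.
  elim: d u => [|d IH] u hd hu; first by rewrite (aug_vanish hu) rpred0.
  have [x xN hx] := step _ _ hu.
  rewrite -(addrK x u) -scaleN1r rpredD //; last exact: rpredZ.
  by apply: IH; [exact: ltnW | rewrite -subSn in hx].
move=> v; have [m [j [hj ->]]] := verma_aug v.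
have -> : vtens 1 m = dxw [::] *: vtens 1 m by rewrite /dxw big_nil scale1r.
by apply: rpredD; [apply: (desc 5) => //; exact: augW | apply: (desc 4)].
Qed.
End Augmentation.

(** * Composition factors *)

Definition Vzero : submodClosed V := submod_generated (fun v : V => v = 0).
Definition Vfull : submodClosed V := submod_generated (fun _ : V => True).

Lemma VzeroP (v : V) : v \in Vzero <-> v = 0.
Proof.
apply: (generatedE (A := fun v : V => v = 0)) => //.
- by move=> u w -> ->; rewrite addr0.
- by move=> a w ->; rewrite scaler0.
Qed.

Lemma VfullP (v : V) : v \in Vfull.
Proof. exact: mem_generated. Qed.

Lemma factor_Vtop_simple : simple_module (subquo Vtop Vzero).
Proof.
apply: subquo_simple => [|N [v vN vZ] _].
  exists (vb 11); first by apply/VtopP; exists 1; rewrite !scale1r.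
  by apply/negP => /VzeroP/eqP; rewrite (negPf vb11_neq0).
by apply: submod_neq0 vN _; apply: contra vZ => /eqP ->; rewrite rpred0.
Qed.

Lemma factor_Vpos_simple : simple_module (subquo Vpos Vtop).
Proof.
apply: subquo_simple => [|N [v vN vS] _]; last exact: submod_notin_Vtop vN vS.
by exists (vb 1); [exact: vb_Vpos | exact: vb1_notin_Vtop].
Qed.

Lemma factor_Vfull_simple : simple_module (subquo Vfull Vpos).
Proof.
apply: subquo_simple => [|N [v vN vX] _ w _]; last exact: submod_notin_Vpos vN vX w.
exists vac; first exact: VfullP.
apply/negP => vX; apply: (@Vpos_notfull) => w; rewrite [w]vcoordE.
by rewrite rpred_sum // => i _; rewrite !rpredZ.
Qed.

Lemma head_iso_Vtop : isomorphic (subquo Vtop Vzero) (simple_L Me).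
Proof.
apply: isomorphic_sym.
pose f (v : V) : V := (vcoord v 0)%:A *: vb 11.
have fS v : f v \in Vtop by apply/VtopP; exists (vcoord v 0).
pose F v : subquo Vtop Vzero := subquo_pi Vzero (Submod (fS v)).
have lin : linear F.
  move=> a u v; rewrite /F -subquo_pi_linear; congr subquo_pi; apply: val_inj.
  rewrite /= -[RHS]/(a *: f u + f v) /f vcoordD !scalerDl.
  have [c [-> h]] := characterP a.
  by rewrite scale_algC h scale_algA mulrC.
have [_ radE] := Vpos_maximal.
apply: (first_isomorphism (f := mk_linear lin)) => [x|v].
  have [u <-] := subquo_pi_surj x; have /VtopP[c uE] := submod_valP u.
  exists (c%:A *: vac); congr subquo_pi; apply: val_inj.
  rewrite /= uE /f vcoordZ.
  by have := @vcoord_vb 0 0 isT isT; rewrite /vb /mono /dxw big_nil scale1r => ->; rewrite mulr1.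
rewrite radE VposP; split=> [v0|/subquo_pi0/VzeroP /= e].
  by apply/subquo_pi0/VzeroP; rewrite /= /f v0 !scale0r.
by have := congr1 (fun v => vcoord v 11) e; rewrite vcoordZ vcoord_vb // vcoord0 mulr1.
Qed.

Lemma head_iso_Vfull : isomorphic (subquo Vfull Vpos) (simple_L Me).
Proof.
apply: isomorphic_sym.
pose F v : subquo Vfull Vpos := subquo_pi Vpos (Submod (VfullP v)).
have lin : linear F.
  by move=> a u v; rewrite /F -subquo_pi_linear; congr subquo_pi; apply: val_inj.
have [_ radE] := Vpos_maximal.
apply: (first_isomorphism (f := mk_linear lin)) => [x|v].
  have [u <-] := subquo_pi_surj x.
  by exists (submod_val u); congr subquo_pi; apply: val_inj.
by rewrite radE; apply: iff_sym; exact: subquo_pi0.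
Qed.

Definition deg1_quo (m : Ms) : subquo Vpos Vtop := subquo_pi Vtop (Submod (deg1_Vpos m)).

Lemma deg1_quo_lift : exists F : {linear verma Ms -> subquo Vpos Vtop},
  forall a m, F (vtens a m) = a *: deg1_quo m.
Proof.
pose p := mk_linear (@subquo_pi_linear _ V Vpos Vtop).
have pE m (u : submod Vpos) : deg1 m = submod_val u -> deg1_quo m = p u.
  by move=> e; rewrite /p mk_linearE; congr subquo_pi; apply: val_inj.
apply: verma_lift => [m m'|c m|g m|h m|t m].
- by rewrite (pE _ (Submod (deg1_Vpos m) + Submod (deg1_Vpos m'))) ?linearD // deg1D.
- by rewrite (pE _ (c%:A *: Submod (deg1_Vpos m))) ?linearZ // deg1Z.
- by rewrite (pE _ (dg g *: Submod (deg1_Vpos m))) ?linearZ // deg1_g.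
- by rewrite (pE _ (dd h *: Submod (deg1_Vpos m))) ?linearZ // deg1_d.
- rewrite -[deg1_quo m]/(p _) -linearZ.
  have -> : dy t *: Submod (deg1_Vpos m) = 0 by apply: val_inj; exact: deg1_y.
  exact: linear0.
Qed.

Lemma aug_deg1_quo (F : {linear verma Ms -> subquo Vpos Vtop}) j :
  (forall a m, F (vtens a m) = a *: deg1_quo m) -> aug 1 j ->
  exists2 u : submod Vpos, F j = subquo_pi Vtop u &
    forall i, (i < 4)%N -> vcoord (submod_val u) i = 0.
Proof.
move=> FE; pose p := mk_linear (@subquo_pi_linear _ V Vpos Vtop).
elim=> [|u1 u2 _ [x1 e1 h1] _ [x2 e2 h2]|w m hw].
- by exists 0; [rewrite linear0 -[RHS]/(p 0) linear0 | move=> i _; exact: vcoord0].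
- exists (x1 + x2); first by rewrite linearD e1 e2 -[RHS]/(p _) linearD.
  by move=> i hi; rewrite vcoordD h1 ?h2 ?addr0.
- exists (dxw w *: Submod (deg1_Vpos m)).
    by rewrite linearZ FE scale1r -[RHS]/(p _) linearZ.
  move=> i hi; rewrite -[submod_val _]/(dxw w *: deg1 m) /deg1 scaler_sumr.
  rewrite vcoord_sum big1 // => t _; rewrite scale_algC scalerA -dxw_rcons vcoordZ.
  rewrite (vcoord_wspan (wspan_dxw _)) ?mulr0 //; first exact: ltn_trans hi _.
  rewrite size_rcons neq_ltn ltnS; apply/orP; left.
  by apply: leq_trans hw; case: i hi => [|[|[|[|]]]].
Qed.

Lemma head_iso_Vpos : isomorphic (subquo Vpos Vtop) (simple_L Ms).
Proof.
apply: isomorphic_sym; have [F FE] := deg1_quo_lift.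
pose p := mk_linear (@subquo_pi_linear _ V Vpos Vtop).
have [_ simQ] := factor_Vpos_simple.
have F1E m : F (vtens 1 m) = deg1_quo m by rewrite FE scale1r.
have image (N : submodClosed (verma Ms)) n : n \in N -> F n != 0 ->
    forall x, exists2 u, u \in N & x = F u.
  move=> nN Fn0 x; apply/linear_image_closed.
  case: (simQ (submod_generated (fun x => exists2 u, u \in N & x = F u))) => [h|]; last exact.
  by case/eqP: Fn0; apply/h/linear_image_closed; exists n.
have lift (N : submodClosed (verma Ms)) n : n \in N -> F n != 0 -> full_submod N.
  move=> nN Fn0; apply: verma_nakayama => m.
  have [u uN Fu] := image N n nN Fn0 (deg1_quo m); exists u => //.
  have [m' [j [hj uE]]] := verma_aug u.
  have [x Fj hx] := aug_deg1_quo FE hj.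
  suff -> : m = m' by rewrite uE addrAC subrr add0r.
  move: Fu; rewrite uE linearD F1E Fj => /eqP.
  rewrite -subr_eq0 -[deg1_quo m]/(p _) -[deg1_quo m']/(p _) -[subquo_pi Vtop x]/(p x).
  rewrite -linearD -linearB => /eqP/subquo_pi0 /= /Vtop_coord hS.
  apply/ffunP => t; apply/eqP; rewrite -subr_eq0; apply/eqP.
  have l3 := letter_lt3 t.
  have l11 : ((letter t).+1 < 11)%N by rewrite ltnS (ltn_trans l3).
  have : vcoord (deg1 m - (deg1 m' + submod_val x)) (letter t).+1 = 0 by exact: hS.
  by rewrite !(vcoordD, vcoordN) !vcoord_deg1 hx // addr0.
pose m1 : Ms := [ffun=> 1].
have F1n0 : F (vtens 1 m1) != 0.
  apply/eqP; rewrite F1E => /subquo_pi0/Vtop_coord/(_ _ (isT : 1 < 11)%N) /eqP.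
  have -> : 1%N = (letter (transp_of 0)).+1 by rewrite transp_ofK.
  by rewrite vcoord_deg1 ffunE oner_eq0.
pose K := submod_generated (fun u => F u = 0).
have KP u : u \in K <-> F u = 0.
  apply: (generatedE (A := fun u => F u = 0)); first exact: linear0.
  - by move=> u1 u2 h1 h2; rewrite linearD h1 h2 addr0.
  - by move=> a u1 h1; rewrite linearZ /= h1 scaler0.
have [|N|_ radE] := @unique_maximalP _ _ K.
- by move=> /(_ (vtens 1 m1))/KP/eqP; rewrite (negPf F1n0).
- have [[n nN Fn0]|h] := EM (exists2 n, n \in N & F n != 0).
    by right; apply: lift nN Fn0.
  left=> n nN; apply/KP/eqP; apply: contrapT => /negP Fn0; apply: h; by exists n.
apply: (first_isomorphism (f := F)) => [x|u]; last by rewrite radE KP.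
have [u _ ->] := image (submod_generated (fun=> True)) (vtens 1 m1)
  (mem_generated I) F1n0 x.
by exists u.
Qed.

Lemma verma_composition : composition_factors V
  (fun i : 'I_3 => simple_L (nth Me [:: Me; Ms; Me] i)).
Proof.
exists (nth Vfull [:: Vzero; Vtop; Vpos]); split; last first.
  exists 1%g => i; rewrite perm1.
  case: i => [[|[|[|//]]] hi] /=.
  - exact: head_iso_Vtop.
  - exact: head_iso_Vpos.
  - exact: head_iso_Vfull.
split=> [v /VzeroP //|v|[|[|[|//]]] _ /=]; first exact: VfullP.
- by split; [move=> v /VzeroP ->; rewrite rpred0 | exact: factor_Vtop_simple].
- by split; [exact: Vtop_sub_Vpos | exact: factor_Vpos_simple].
- by split; [move=> v _; exact: VfullP | exact: factor_Vfull_simple].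
Qed.

End VermaModule.

Theorem theorem8 (k : closedFieldType) (k_char0 : [pchar k] =i pred0) :
  let Me : ds3mod k := Mod_e_plus k in
  let Ms : ds3mod k := Mod_sigma_minus k in
  let V : lmodType (fkdouble k) := verma Me in
  let X : submodClosed V := mod_radical V in
  let S : submodClosed V := mod_socle V in
  [/\ unique_maximal_submod X /\
      (forall N : submodClosed V,
         ~ zero_submod N /\ ~ full_submod N <-> N =i S \/ N =i X),
      {subset S <= X} /\ ~ {subset X <= S},
      internal_direct_sum (fun i : 'I_4 => @vdeg k Me i.+1) X /\
      highest_weight Ms X,
      (forall v : V, v \in S <-> @vdeg k Me 4 v) /\
      highest_weight Me S &
      composition_factors V
        (fun i : 'I_3 => simple_L (nth Me [:: Me; Ms; Me] i))].
Proof.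
have [maxX radE] := Vpos_maximal k; split.
- by split; [exact: maxX | exact: submod_classification].
- split=> [v|h]; first by rewrite mod_socleE radE; exact: Vtop_sub_Vpos.
  by have := vb1_notin_Vtop k; rewrite -mod_socleE h // radE; exact: vb_Vpos.
- by split; [exact: Vpos_direct_sum | exact: highest_weight_Vpos].
- by split; [exact: Vtop_degree | exact: highest_weight_Vtop].
- exact: verma_composition.
Qed.
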